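(* Let $k$ be a field and let $A$ be an sf Brauer graph $k$-algebra associated with the sf Brauer graph $(\Gamma_L,\mathsf m)$, where $\Gamma$ is a ribbon graph, $L$ is a set of labeled edges in $\Gamma$ and $\mathsf m$ is a multiplicity function. If $A$ is of finite representation type, then $(\Gamma\backslash L,\mathsf m)$ is a Brauer tree.
   Context: Paths are written from right to left: $p=\alpha_n\cdots\alpha_1$ starts with $\alpha_1$; $s(p),t(p)$ are source and target. Ribbon graphs. A ribbon graph is $\Gamma=(V,H,s,\iota,\rho)$ with $V$ a finite set (vertices), $H$ a finite set (half-edges), $s:H\to V$ a map, $\iota:H\to H$ an involution without fixed points, and $\rho:H\to H$ a permutation whose cycles correspond to the sets $H_v:=s^{-1}(v)$, $v\in V$. Its edges are the sets $\bar h=\{h,\iota(h)\}$; $E(\Gamma)$ is the set of edges; $h^+=\rho(h)$, $h^-=\rho^{-1}(h)$; $\mathrm{val}(v)=|H_v|$. Ribbon graphs are assumed connected. An edge $\bar h$ is labelable if $\iota(\rho(h))=\rho(\iota(h))$. A labeled ribbon graph $\Gamma_L=(\Gamma,L)$ is a ribbon graph with a set $L\subseteq E(\Gamma)$ of labelable edges such that for every $v\in V$ with $\mathrm{val}(v)\ge2$ there are at least two half-edges in $H_v$ whose edges are not in $L$; edges in $L$ are called labeled. An sf (symmetric fractional) Brauer graph is a pair $(\Gamma_L,\mathsf m)$ with $\Gamma_L$ a labeled ribbon graph and $\mathsf m:V\to\mathbb Z_{>0}$ a function (the multiplicity function). A vertex $v$ is truncated if $\mathsf m(v)=1$ and $\mathrm{val}(v)=1$.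 Let $H'$ be the set of half-edges $h$ with $s(h)$ not truncated, and $E(\Gamma)'$ the set of edges $\bar h$ with neither $s(h)$ nor $s(\iota(h))$ truncated. The quiver $Q_\Gamma$ has vertex set $E(\Gamma)$ and one arrow $\alpha_h:\bar h\to\overline{h^+}$ for every $h\in H'$. Let $\sigma$ be the permutation of the arrows given by $\sigma(\alpha_h)=\alpha_{h^-}$. For an arrow $\alpha$ whose $\sigma$-orbit has $l+1$ elements, the special cycle is $C_\alpha=\alpha\sigma(\alpha)\cdots\sigma^l(\alpha)$ (a cycle at $t(\alpha)$), and $\mathsf m(C_{\alpha_h}):=\mathsf m(s(h))$. The quiver $Q_{\Gamma,L}$ is the quiver of $kQ_\Gamma/I_L$, where $I_L$ is the ideal generated by all $\alpha-\beta$ with $\alpha,\beta$ arrows of $Q_\Gamma$ starting at the same labeled edge; i.e. all arrows starting at the same labeled edge are identified. Let $\pi:kQ_\Gamma\to kQ_{\Gamma,L}$ be the projection. The ideal $I_{\Gamma,L}$ of $kQ_{\Gamma,L}$ is generated by: (i) for each $\bar h\in E(\Gamma)'$, with $C_\alpha,C_\beta$ the two special cycles of $Q_\Gamma$ ending at $\bar h$, write $\pi(C_\alpha^{\mathsf m(C_\alpha)})=\alpha_n\cdots\alpha_1$ and $\pi(C_\beta^{\mathsf m(C_\beta)})=\beta_m\cdots\beta_1$ as products of arrows of $Q_{\Gamma,L}$, let $l_1$ (resp. $l_2$) be the smallest positive integer with $\alpha_{l_1}\ne\beta_{l_1}$ (resp. $\alpha_{n-l_2+1}\neq\beta_{m-l_2+1}$),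 and impose $\alpha_{n-l_2+1}\cdots\alpha_{l_1}=\beta_{m-l_2+1}\cdots\beta_{l_1}$; (ii) for each $h\in H'$, $\pi(C_{\alpha_h}^{\mathsf m(C_{\alpha_h})}\alpha_h)=0$; (iii) $\pi(p)=0$ for every path $p=\alpha_n\cdots\alpha_1$ in $Q_\Gamma$ such that $\alpha_2,\dots,\alpha_{n-1}$ start at labeled edges, $\alpha_1$ and $\alpha_n$ do not start at labeled edges, and $\sigma^{n-1}(\alpha_n)\ne\alpha_1$. A $k$-algebra is an sf Brauer graph algebra associated with $(\Gamma_L,\mathsf m)$ if it is isomorphic to $kQ_{\Gamma,L}/I_{\Gamma,L}$. The ribbon graph $\Gamma\backslash L=(V',H^{\ast},s',\iota',\rho')$: $V'=V$; $H^{\ast}\subseteq H$ is the set of half-edges not lying in any edge of $L$; $s',\iota'$ are the restrictions of $s,\iota$ to $H^{\ast}$; for $h\in H^{\ast}$, $\rho'(h)=\rho^i(h)$ with $i$ the smallest positive integer such that $\rho^i(h)$ does not lie in an edge of $L$. A pair (ribbon graph, function $\mathsf m$ from vertices to $\mathbb Z_{>0}$) is a Brauer tree if the underlying graph is a tree and $\mathsf m$ takes the value $1$ at all vertices except possibly one.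
   Formalization: It is assumed that not every edge of Γ is labeled; this excludes only the case where Γ is a single labeled edge with two distinct endpoints, for which Γ\L is two isolated vertices and the claim fails (e.g. multiplicities 1, 1, A = k). *)

(* Defs.v *)
From HB Require Import structures.
From mathcomp Require Import all_boot all_order all_fingroup all_algebra.
From mathcomp Require Import generic_quotient.
From mathcomp Require Import finmap boolp.
From mathcomp.multinomials Require Import monalg.

Set Implicit Arguments.
Unset Strict Implicit.
Unset Printing Implicit Defensive.

Import GRing.Theory.
Local Open Scope ring_scope.
Local Open Scope quotient_scope.

Record quiver := Quiver {
  qvert : finType;
  qarrow : choiceType;
  qsrc : qarrow -> qvert;
  qtgt : qarrow -> qvert;
  qvert_gt0 : (0 < #|qvert|)%N
}.

Section Paths.
Variable Q : quiver.

(* Paths are written from right to left: the path alpha_n ... alpha_1 is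
   stored as its target vertex together with the word
   [:: alpha_n; ...; alpha_1]; the vertex is only needed to tell the trivial
   paths apart. *)
Fixpoint is_path (t : qvert Q) (w : seq (qarrow Q)) : bool :=
  if w is a :: w' then (qtgt a == t) && is_path (qsrc a) w' else true.

Record qpath := QPath {
  pval : qvert Q * seq (qarrow Q);
  pvalP : is_path pval.1 pval.2
}.
HB.instance Definition _ := [isSub for pval].
HB.instance Definition _ := [Choice of qpath by <:].

Definition ptgt (p : qpath) : qvert Q := (val p).1.
Definition pword (p : qpath) : seq (qarrow Q) := (val p).2.
Definition psrc (p : qpath) : qvert Q := last (ptgt p) (map (@qsrc Q) (pword p)).

Lemma is_path_cat t w1 w2 :
  is_path t (w1 ++ w2) = is_path t w1 && is_path (last t (map (@qsrc Q) w1)) w2.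
Proof. by elim: w1 t => //= a w1 IH t; rewrite IH andbA. Qed.

Definition triv_path (v : qvert Q) : qpath := @QPath (v, [::]) isT.

Lemma is_path_arrow (a : qarrow Q) : is_path (qtgt a) [:: a].
Proof. by rewrite /= eqxx. Qed.
Definition arrow_path (a : qarrow Q) : qpath :=
  @QPath (qtgt a, [:: a]) (is_path_arrow a).

(* [pcomp p q] is the concatenation pq: first q, then p. *)
Definition pcomp (p q : qpath) : option qpath :=
  if psrc p == ptgt q then insub (ptgt p, pword p ++ pword q) else None.

Lemma pcompE p q : psrc p = ptgt q ->
  exists2 r, pcomp p q = Some r & val r = (ptgt p, pword p ++ pword q).
Proof.
move=> epq; rewrite /pcomp epq eqxx; case: insubP => /= [r _ vr|]; first by exists r.
rewrite is_path_cat -/(psrc p) epq.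
by case: p q {epq} => -[tp wp] /= Pp [[tq wq] /= Pq]; rewrite /ptgt /pword /= Pp Pq.
Qed.

Lemma pcomp_None p q : psrc p != ptgt q -> pcomp p q = None.
Proof. by rewrite /pcomp => /negPf ->. Qed.

Lemma pcomp_src p q r : pcomp p q = Some r -> psrc r = psrc q.
Proof.
case: (eqVneq (psrc p) (ptgt q)) => [e|/pcomp_None -> //].
have [r' -> vr'] := pcompE e; case=> <-.
by rewrite /psrc /ptgt /pword vr' /= map_cat last_cat -/(psrc p) e.
Qed.

Lemma pcomp_tgt p q r : pcomp p q = Some r -> ptgt r = ptgt p.
Proof.
case: (eqVneq (psrc p) (ptgt q)) => [e|/pcomp_None -> //].
by have [r' -> vr'] := pcompE e; case=> <-; rewrite /ptgt vr'.
Qed.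

Lemma pcompA p q r :
  obind (fun u => pcomp u r) (pcomp p q) = obind (pcomp p) (pcomp q r).
Proof.
case: (eqVneq (psrc p) (ptgt q)) => [e1|n1]; last first.
  rewrite (pcomp_None n1) /=; case E: (pcomp q r) => [u|] //=.
  by rewrite pcomp_None // (pcomp_tgt E).
have [u Eu vu] := pcompE e1; rewrite Eu /=.
case: (eqVneq (psrc q) (ptgt r)) => [e2|n2]; last first.
  by rewrite (pcomp_None n2) /= pcomp_None // (pcomp_src Eu).
have [v Ev vv] := pcompE e2; rewrite Ev /=.
have [|x -> vx] := @pcompE u r; first by rewrite (pcomp_src Eu).
have [|y -> vy] := @pcompE p v; first by rewrite (pcomp_tgt Ev).
congr Some; apply: val_inj; rewrite vx vy.
by rewrite /ptgt /pword vu vv /= catA.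
Qed.

Lemma pcomp_triv_l v p :
  pcomp (triv_path v) p = if v == ptgt p then Some p else None.
Proof.
case: (eqVneq v (ptgt p)) => [->|n]; last by rewrite pcomp_None.
have [r -> vr] := @pcompE (triv_path (ptgt p)) p erefl.
by congr Some; apply: val_inj; rewrite vr /ptgt /pword /=; case: (val p).
Qed.

Lemma pcomp_triv_r p v :
  pcomp p (triv_path v) = if v == psrc p then Some p else None.
Proof.
case: (eqVneq v (psrc p)) => [->|n]; last by rewrite pcomp_None // eq_sym.
have [r -> vr] := @pcompE p (triv_path (psrc p)) erefl.
by congr Some; apply: val_inj; rewrite vr /ptgt /pword /= cats0; case: (val p).
Qed.

End Paths.

Section LinearExtension.
Variables (k : fieldType) (K : choiceType) (V : lmodType k).
Implicit Types (h : K -> V) (g : {malg k[K]}).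

Definition lin_ext h g : V := \sum_(x <- msupp g) g@_x *: h x.

Lemma lin_extEw h g (d : {fset K}) : (msupp g `<=` d)%fset ->
  lin_ext h g = \sum_(x <- d) g@_x *: h x.
Proof.
move=> le; rewrite /lin_ext; apply: big_fset_incl => // x _.
by move/mcoeff_outdom ->; rewrite scale0r.
Qed.

Lemma lin_ext_is_linear h : linear (lin_ext h).
Proof.
move=> c g1 g2; pose d := (msupp g1 `|` msupp g2 `|` msupp (c *: g1 + g2))%fset.
rewrite !(@lin_extEw h _ d) ?fsubsetUr //.
- rewrite scaler_sumr -big_split /=; apply: eq_bigr => x _.
  by rewrite mcoeffD mcoeffZ scalerDl scalerA.
- by rewrite /d -fsetUA fsetUCA fsubsetUl.
- by rewrite /d -fsetUA fsubsetUl.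
Qed.
HB.instance Definition _ h :=
  GRing.isLinear.Build k {malg k[K]} V _ (lin_ext h) (lin_ext_is_linear h).

Lemma lin_extU h x : lin_ext h << x >> = h x.
Proof.
rewrite (@lin_extEw h _ [fset x]%fset) ?msuppU_le //.
by rewrite big_seq_fset1 mcoeffUU scale1r.
Qed.

Lemma lin_extDh c h1 h2 g :
  lin_ext (fun x => c *: h1 x + h2 x) g = c *: lin_ext h1 g + lin_ext h2 g.
Proof.
rewrite /lin_ext scaler_sumr -big_split /=; apply: eq_bigr => x _.
by rewrite scalerDr !scalerA mulrC.
Qed.

Lemma lin_extZh c h g : lin_ext (fun x => c *: h x) g = c *: lin_ext h g.
Proof.
by rewrite /lin_ext scaler_sumr; apply: eq_bigr => x _; rewrite !scalerA mulrC.
Qed.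

Lemma malg_lin_eq (f1 f2 : {malg k[K]} -> V) :
  linear f1 -> linear f2 -> (forall x, f1 << x >> = f2 << x >>) -> f1 =1 f2.
Proof.
move=> l1 l2 e g; pose F1 : {linear _ -> _} := HB.pack f1 (GRing.isLinear.Build _ _ _ _ f1 l1).
pose F2 : {linear _ -> _} := HB.pack f2 (GRing.isLinear.Build _ _ _ _ f2 l2).
rewrite -[f1]/(F1 : _ -> _) -[f2]/(F2 : _ -> _) (monalgE g) !linear_sum.
apply: eq_bigr => x _.
have -> : << g@_x *g x >> = g@_x *: << x >> :> {malg k[K]}.
  by apply/malgP => y; rewrite mcoeffZ !mcoeffU mulrnAr mulr1.
by rewrite !linearZ /= e.
Qed.

End LinearExtension.

HB.lock Definition path_elt (k : fieldType) (Q : quiver) (p : qpath Q) :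
  {malg k[qpath Q]} := << p >>.

Definition pcomp_elt (k : fieldType) (Q : quiver) (p q : qpath Q) :
    {malg k[qpath Q]} :=
  if pcomp p q is Some r then path_elt k r else 0.

(* The bilinear extension of concatenation of paths. *)
HB.lock Definition pa_mul (k : fieldType) (Q : quiver) (f g : {malg k[qpath Q]}) :
  {malg k[qpath Q]} := lin_ext (fun p => lin_ext (pcomp_elt k p) g) f.

Section PathAlgebra.
Variables (k : fieldType) (Q : quiver).
Local Notation malgQ := {malg k[qpath Q]}.
Local Notation path_elt := (path_elt k).
Local Notation pcomp_elt := (pcomp_elt k).
Local Notation pa_mul := (@pa_mul k Q).

Lemma path_eltE (p : qpath Q) : path_elt p = << p >>.
Proof. by rewrite path_elt.unlock. Qed.

Definition pa_one : malgQ := \sum_(v : qvert Q) path_elt (triv_path v).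

Lemma pa_mull g : linear (pa_mul^~ g).
Proof. by rewrite pa_mul.unlock; exact: lin_ext_is_linear. Qed.

Lemma pa_mulr f : linear (pa_mul f).
Proof.
rewrite pa_mul.unlock => c g1 g2.
have e : (fun p => lin_ext (pcomp_elt p) (c *: g1 + g2)) =
         (fun p => c *: lin_ext (pcomp_elt p) g1 + lin_ext (pcomp_elt p) g2).
  by apply/funext => p; exact: (lin_ext_is_linear (pcomp_elt p) c g1 g2).
exact: etrans (congr1 (fun h => lin_ext h f) e) (lin_extDh c _ _ f).
Qed.

Lemma pa_mulUU (p q : qpath Q) : pa_mul (path_elt p) (path_elt q) = pcomp_elt p q.
Proof. by rewrite pa_mul.unlock path_elt.unlock !lin_extU. Qed.

Lemma pa_mul0g g : pa_mul 0 g = 0.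
Proof. by have := pa_mull g (-1) 0 0; rewrite scaler0 addr0 scaleN1r addNr. Qed.

Lemma pa_mulg0 f : pa_mul f 0 = 0.
Proof.
by have := pa_mulr f (-1) 0 0; rewrite scaler0 addr0 scaleN1r addNr.
Qed.

Lemma pa_mulA : associative pa_mul.
Proof.
move=> f g h.
apply: (@malg_lin_eq k _ malgQ (fun f => pa_mul f (pa_mul g h))
          (fun f => pa_mul (pa_mul f g) h)) => [c x y|c x y|p].
- exact: (pa_mull (pa_mul g h) c x y).
- by rewrite (pa_mull g c x y) (pa_mull h c).
rewrite -path_eltE.
apply: (@malg_lin_eq k _ malgQ (fun g => pa_mul (path_elt p) (pa_mul g h))
          (fun g => pa_mul (pa_mul (path_elt p) g) h)) => [c x y|c x y|q].
- by rewrite (pa_mull h c x y) (pa_mulr (path_elt p) c).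
- by rewrite (pa_mulr (path_elt p) c x y) (pa_mull h c).
rewrite -path_eltE.
apply: (@malg_lin_eq k _ malgQ
          (fun h => pa_mul (path_elt p) (pa_mul (path_elt q) h))
          (fun h => pa_mul (pa_mul (path_elt p) (path_elt q)) h)) => [c x y|c x y|r].
- by rewrite (pa_mulr (path_elt q) c x y) (pa_mulr (path_elt p) c).
- exact: (@pa_mulr (pa_mul (path_elt p) (path_elt q)) c x y).
rewrite -path_eltE !pa_mulUU.
have := pcompA p q r; rewrite /pcomp_elt.
case: (pcomp p q) => [u|]; case: (pcomp q r) => [v|] /=;
  rewrite ?pa_mulUU ?pa_mul0g ?pa_mulg0 // /pcomp_elt => e.
- by rewrite e.
- by rewrite e.
- by rewrite -e.
Qed.

Lemma pa_mul1g : left_id pa_one pa_mul.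
Proof.
move=> f; apply: (@malg_lin_eq k _ malgQ (pa_mul pa_one) id) => // [|p].
  exact: pa_mulr.
pose F : {linear malgQ -> malgQ} :=
  HB.pack (pa_mul^~ (path_elt p)) (GRing.isLinear.Build _ _ _ _ _ (pa_mull (path_elt p))).
rewrite -path_eltE -[pa_mul _ _]/(F pa_one) /pa_one linear_sum /= (bigD1 (ptgt p)) //=.
rewrite pa_mulUU /pcomp_elt pcomp_triv_l eqxx big1 ?addr0 // => v nv.
by rewrite pa_mulUU /pcomp_elt pcomp_triv_l (negPf nv).
Qed.

Lemma pa_mulg1 : right_id pa_one pa_mul.
Proof.
move=> f; apply: (@malg_lin_eq k _ malgQ (pa_mul^~ pa_one) id) => // [|p].
  exact: pa_mull.
pose F : {linear malgQ -> malgQ} :=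
  HB.pack (pa_mul (path_elt p)) (GRing.isLinear.Build _ _ _ _ _ (pa_mulr (path_elt p))).
rewrite -path_eltE -[pa_mul _ _]/(F pa_one) /pa_one linear_sum /= (bigD1 (psrc p)) //=.
rewrite pa_mulUU /pcomp_elt pcomp_triv_r eqxx big1 ?addr0 // => v nv.
by rewrite pa_mulUU /pcomp_elt pcomp_triv_r (negPf nv).
Qed.

Lemma pa_mulDl : left_distributive pa_mul +%R.
Proof. by move=> f g h; rewrite -[f]scale1r pa_mull !scale1r. Qed.

Lemma pa_mulDr : right_distributive pa_mul +%R.
Proof. by move=> f g h; rewrite -[g]scale1r pa_mulr !scale1r. Qed.

Lemma pa_scaleAl (c : k) f g : c *: pa_mul f g = pa_mul (c *: f) g.
Proof. by rewrite -[c *: f in RHS]addr0 pa_mull pa_mul0g (addr0 (c *: _)). Qed.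

Lemma pa_scaleAr (c : k) f g : c *: pa_mul f g = pa_mul f (c *: g).
Proof. by rewrite -[c *: g in RHS]addr0 pa_mulr pa_mulg0 (addr0 (c *: _)). Qed.

Lemma pa_one_neq0 : pa_one != 0.
Proof.
have /card_gt0P [v _] := qvert_gt0 Q.
apply/eqP => /(congr1 (mcoeff (triv_path v))).
rewrite mcoeff0 /pa_one path_elt.unlock raddf_sum /= (bigD1 v) //= mcoeffUU big1 => [|w nw].
  by rewrite addr0 => /eqP; rewrite oner_eq0.
by rewrite mcoeffU; case: eqP => // -[] /eqP; rewrite (negPf nw).
Qed.

Definition pathAlg := malgQ.
HB.instance Definition _ := GRing.Lmodule.copy pathAlg malgQ.
HB.instance Definition _ := GRing.Zmodule_isNzRing.Build pathAlg
  pa_mulA pa_mul1g pa_mulg1 pa_mulDl pa_mulDr pa_one_neq0.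

HB.instance Definition _ := GRing.Lmodule_isLalgebra.Build k pathAlg pa_scaleAl.
HB.instance Definition _ := GRing.Lalgebra_isAlgebra.Build k pathAlg pa_scaleAr.

Lemma path_eltM (p q : qpath Q) :
  (path_elt p : pathAlg) * (path_elt q : pathAlg) = pcomp_elt p q.
Proof. exact: pa_mulUU. Qed.

Definition arrow_elt (a : qarrow Q) : pathAlg := path_elt (arrow_path a).

(* The element alpha_n ... alpha_1 of the path algebra, for the word
   [:: alpha_n; ...; alpha_1]. *)
Definition word_elt (w : seq (qarrow Q)) : pathAlg :=
  \prod_(a <- w) arrow_elt a.

End PathAlgebra.

Section IdealQuotient.
Variables (k : fieldType) (B : algType k) (S : B -> Prop).

(* The two-sided ideal generated by S: all finite sums of elements x s y. *)
Definition ideal_gen (b : B) : Prop :=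
  exists2 l : seq (B * B * B),
    (forall t, t \in l -> S t.1.2) & b = \sum_(t <- l) t.1.1 * t.1.2 * t.2.

Definition ideal_pred : pred B := fun b => `[< ideal_gen b >].

Lemma ideal_gen0 : ideal_gen 0.
Proof. by exists [::]; rewrite ?big_nil. Qed.

Lemma ideal_genD x y : ideal_gen x -> ideal_gen y -> ideal_gen (x + y).
Proof.
move=> [l1 S1 ->] [l2 S2 ->]; exists (l1 ++ l2); last by rewrite big_cat.
by move=> t; rewrite mem_cat => /orP[/S1|/S2].
Qed.

Lemma ideal_genMl x y : ideal_gen x -> ideal_gen (y * x).
Proof.
move=> [l S1 ->]; exists [seq (y * t.1.1, t.1.2, t.2) | t <- l].
  by move=> t /mapP[u /S1 Su ->].
by rewrite big_map mulr_sumr; apply: eq_bigr => t _; rewrite /= !mulrA.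
Qed.

Lemma ideal_genMr x y : ideal_gen x -> ideal_gen (x * y).
Proof.
move=> [l S1 ->]; exists [seq (t.1.1, t.1.2, t.2 * y) | t <- l].
  by move=> t /mapP[u /S1 Su ->].
by rewrite big_map mulr_suml; apply: eq_bigr => t _; rewrite /= !mulrA.
Qed.

Lemma ideal_genZ c x : ideal_gen x -> ideal_gen (c *: x).
Proof. by move=> /(@ideal_genMl _ (c *: 1)); rewrite -scalerAl mul1r. Qed.

Lemma ideal_pred_zmod : zmod_closed ideal_pred.
Proof.
split=> [|x y]; first exact/asboolP/ideal_gen0.
move=> /asboolP Ix /asboolP Iy; apply/asboolP/ideal_genD => //.
by rewrite -scaleN1r; apply: ideal_genZ.
Qed.

Definition ideal_zmod : zmodClosed B :=
  HB.pack_for (zmodClosed B) (ideal_pred : B -> bool)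
    (GRing.isZmodClosed.Build B ideal_pred ideal_pred_zmod).

Definition quotAlg : Type := {ideal_quot ideal_zmod}.
HB.instance Definition _ := GRing.Zmodule.copy quotAlg {ideal_quot ideal_zmod}.
HB.instance Definition _ := Quotient.copy quotAlg {ideal_quot ideal_zmod}.

Definition qpi (x : B) : quotAlg := \pi_({ideal_quot ideal_zmod}) x.

Lemma qpi_eq x y : (qpi x = qpi y) <-> ideal_gen (x - y).
Proof.
rewrite /qpi; split=> [/eqP|/asboolP h]; first by rewrite -Quotient.idealrBE => /asboolP.
by apply/eqP; rewrite -Quotient.idealrBE.
Qed.

Lemma qpi_repr (x : quotAlg) : qpi (repr x) = x.
Proof. exact: reprK. Qed.

Lemma qpiD x y : qpi (x + y) = qpi x + qpi y.
Proof. exact: Quotient.pi_add. Qed.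

Lemma qpi_ind (P : quotAlg -> Prop) : (forall x, P (qpi x)) -> forall x, P x.
Proof. by move=> h x; rewrite -(qpi_repr x). Qed.

Definition quot_one : quotAlg := qpi 1.
Definition quot_mul (x y : quotAlg) : quotAlg := qpi (repr x * repr y).
Definition quot_scale (c : k) (x : quotAlg) : quotAlg := qpi (c *: repr x).

Lemma repr_qpi x : ideal_gen (repr (qpi x) - x).
Proof. by apply/qpi_eq; rewrite qpi_repr. Qed.

Lemma quot_mulE x y : quot_mul (qpi x) (qpi y) = qpi (x * y).
Proof.
apply/qpi_eq; set x' := repr _; set y' := repr _.
have -> : x' * y' - x * y = (x' - x) * y' + x * (y' - y).
  by rewrite mulrBl mulrBr addrA subrK.
apply: ideal_genD; first exact/ideal_genMr/repr_qpi.
exact/ideal_genMl/repr_qpi.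
Qed.

Lemma quot_scaleE c x : quot_scale c (qpi x) = qpi (c *: x).
Proof. by apply/qpi_eq; rewrite -scalerBr; apply/ideal_genZ/repr_qpi. Qed.

Lemma quot_mulA : associative quot_mul.
Proof.
by elim/qpi_ind=> x; elim/qpi_ind=> y; elim/qpi_ind=> z; rewrite !quot_mulE mulrA.
Qed.
Lemma quot_mul1 : left_id quot_one quot_mul.
Proof. by elim/qpi_ind=> x; rewrite quot_mulE mul1r. Qed.
Lemma quot_mulr1 : right_id quot_one quot_mul.
Proof. by elim/qpi_ind=> x; rewrite quot_mulE mulr1. Qed.
Lemma quot_mulDl : left_distributive quot_mul +%R.
Proof.
elim/qpi_ind=> x; elim/qpi_ind=> y; elim/qpi_ind=> z.
by rewrite -qpiD !quot_mulE -qpiD mulrDl.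
Qed.
Lemma quot_mulDr : right_distributive quot_mul +%R.
Proof.
elim/qpi_ind=> x; elim/qpi_ind=> y; elim/qpi_ind=> z.
by rewrite -qpiD !quot_mulE -qpiD mulrDr.
Qed.

(* No nontriviality: the quotient is the zero ring when 1 lies in the ideal. *)
HB.instance Definition _ := GRing.Zmodule_isPzRing.Build quotAlg
  quot_mulA quot_mul1 quot_mulr1 quot_mulDl quot_mulDr.

Lemma quot_scaleA a b x : quot_scale a (quot_scale b x) = quot_scale (a * b) x.
Proof. by elim/qpi_ind: x => x; rewrite !quot_scaleE scalerA. Qed.
Lemma quot_scale1 : left_id 1 quot_scale.
Proof. by elim/qpi_ind=> x; rewrite quot_scaleE scale1r. Qed.
Lemma quot_scaleDr : right_distributive quot_scale +%R.
Proof.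
move=> c; elim/qpi_ind=> x; elim/qpi_ind=> y.
by rewrite -qpiD !quot_scaleE -qpiD scalerDr.
Qed.
Lemma quot_scaleDl x : {morph quot_scale^~ x : a b / a + b}.
Proof. by move=> a b; elim/qpi_ind: x => x; rewrite !quot_scaleE -qpiD scalerDl. Qed.

HB.instance Definition _ := GRing.Zmodule_isLmodule.Build k quotAlg
  quot_scaleA quot_scale1 quot_scaleDr quot_scaleDl.

End IdealQuotient.

Section RepresentationType.
Variable R : pzRingType.

Definition lmod_iso (M N : lmodType R) : Prop :=
  exists f : {linear M -> N}, bijective f.

Definition finitely_generated (M : lmodType R) : Prop :=
  exists n (x : 'I_n -> M),
    forall m, exists c : 'I_n -> R, m = \sum_i c i *: x i.

Definition zero_module (M : lmodType R) : Prop := forall m : M, m = 0.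

Definition indecomposable (M : lmodType R) : Prop :=
  ~ zero_module M /\
  forall M1 M2 : lmodType R,
    lmod_iso M (M1 * M2)%type -> zero_module M1 \/ zero_module M2.

Definition finite_representation_type : Prop :=
  exists n (M : 'I_n -> lmodType R),
    forall N : lmodType R,
      finitely_generated N -> indecomposable N -> exists i, lmod_iso N (M i).

End RepresentationType.

Record ribbonGraph := RibbonGraph {
  vertex : finType;
  halfedge : finType;
  hsrc : halfedge -> vertex;
  hinv : halfedge -> halfedge;
  hrot : {perm halfedge};
  hinvK : involutive hinv;
  hinv_neq : forall h, hinv h != h;
  hrotP : porbits hrot = [set hsrc @^-1: [set v] | v : vertex]
}.
Arguments hsrc {_} _.
Arguments hinv {_} _.

Section RibbonGraph.
Variable G : ribbonGraph.

Definition halves_at (v : vertex G) : {set halfedge G} := [set h | hsrc h == v].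
Definition valency (v : vertex G) : nat := #|halves_at v|.

Lemma porbit_hrot (h : halfedge G) : porbit (hrot G) h = halves_at (hsrc h).
Proof.
have : porbit (hrot G) h \in porbits (hrot G) by apply: imset_f.
rewrite hrotP => /imsetP[v _ e].
have : h \in porbit (hrot G) h by apply: porbit_id.
by rewrite e !inE => /eqP <-; apply/setP => g; rewrite !inE.
Qed.

Lemma hsrc_porbit (h g : halfedge G) :
  (g \in porbit (hrot G) h) = (hsrc g == hsrc h).
Proof. by rewrite porbit_hrot inE. Qed.

Lemma hsrc_rot (h : halfedge G) : hsrc (hrot G h) = hsrc h.
Proof. by apply/eqP; rewrite -hsrc_porbit -[hrot G]expg1 mem_porbit. Qed.

Lemma hsrc_rotV (h : halfedge G) : hsrc ((hrot G)^-1%g h) = hsrc h.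
Proof. by rewrite -[in RHS](permKV (hrot G) h) hsrc_rot. Qed.

Lemma half_at_vert (v : vertex G) : exists h : halfedge G, hsrc h = v.
Proof.
have : hsrc @^-1: [set v] \in porbits (hrot G) by rewrite hrotP; apply: imset_f.
case/imsetP=> h _ e; exists h.
by have := porbit_id (hrot G) h; rewrite -e !inE => /eqP.
Qed.

Definition edge : finType :=
  {e : {set halfedge G} | e \in [set [set h; hinv h] | h : halfedge G]}.

Definition edge_of (h : halfedge G) : edge := exist _ [set h; hinv h] (imset_f _ isT).

Lemma edge_ofE (h g : halfedge G) :
  (edge_of g == edge_of h) = (g == h) || (g == hinv h).
Proof.
rewrite -val_eqE /=; apply/eqP/idP => [e|].
  have gg : g \in [set g; hinv g] by rewrite !inE eqxx.
  by move: gg; rewrite e !inE.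
case/orP=> /eqP-> //; rewrite hinvK; exact: setUC.
Qed.

Lemma edge_of_inv (h : halfedge G) : edge_of (hinv h) = edge_of h.
Proof. by apply/eqP; rewrite edge_ofE eqxx orbT. Qed.

Lemma edge_ofP (e : edge) : exists h, edge_of h = e.
Proof.
by case: e => e He; case/imsetP: (He) => h _ eh; exists h; apply: val_inj.
Qed.

Definition adjacent (v w : vertex G) : bool :=
  [exists h : halfedge G, (hsrc h == v) && (hsrc (hinv h) == w)].

Definition rg_connected : Prop :=
  (0 < #|vertex G|)%N /\ forall v w, connect adjacent v w.

(* The half-edge h is read as an oriented step from hsrc h to hsrc (hinv h).
   Loops and pairs of parallel edges are cycles. *)
Definition is_cycle (c : seq (halfedge G)) : Prop :=
  [/\ c != [::],
      path.cycle (fun h g => hsrc (hinv h) == hsrc g) c,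
      uniq (map hsrc c) &
      uniq (map edge_of c)].

Definition is_tree : Prop := rg_connected /\ forall c, ~ is_cycle c.

Definition brauer_tree (m : vertex G -> nat) : Prop :=
  is_tree /\ exists v0, forall v, v != v0 -> m v = 1%N.

Definition labelable (e : edge) : Prop :=
  forall h, edge_of h = e -> hinv (hrot G h) = hrot G (hinv h).

End RibbonGraph.

Record labeledRibbonGraph := LabeledRibbonGraph {
  lrg :> ribbonGraph;
  lrg_connected : rg_connected lrg;
  labels : {set edge lrg};
  labels_labelable : forall e, e \in labels -> labelable e;
  labels_val : forall v : vertex lrg, (2 <= valency v)%N ->
    (2 <= #|[set h in halves_at v | edge_of h \notin labels]|)%N
}.

Record sfBrauerGraph := SfBrauerGraph {
  sf_lrg :> labeledRibbonGraph;
  mult : vertex sf_lrg -> nat;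
  mult_gt0 : forall v, (0 < mult v)%N
}.

Section Relations.
Variable B : sfBrauerGraph.

Definition truncated (v : vertex B) : bool := (mult v == 1%N) && (valency v == 1%N).

Lemma edge_gt0 : (0 < #|edge B|)%N.
Proof.
have [/card_gt0P[v _] _] := lrg_connected B.
by have [h _] := half_at_vert v; apply/card_gt0P; exists (edge_of h).
Qed.

(* The arrow alpha_h is the half-edge h itself. *)
Definition arrow : finType :=
  {h : halfedge B | ~~ truncated (hsrc h)}.
Definition arr_src (a : arrow) : edge B := edge_of (val a).
Definition arr_tgt (a : arrow) : edge B := edge_of (hrot B (val a)).
Definition Qgraph : quiver := Quiver arr_src arr_tgt edge_gt0.

Lemma sigma_subproof (a : arrow) : ~~ truncated (hsrc ((hrot B)^-1%g (val a))).
Proof. by rewrite hsrc_rotV; apply: (valP a). Qed.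
Definition sigma (a : arrow) : arrow :=
  exist (fun h => ~~ truncated (hsrc h)) _ (sigma_subproof a).

Lemma sigma_inj : injective sigma.
Proof. by move=> a b /(congr1 val) /= /perm_inj/val_inj. Qed.

(* [:: a; sigma a; ...; sigma^l a], with l + 1 the size of the sigma-orbit. *)
Definition special_cycle (a : arrow) : seq arrow :=
  traject sigma a (fingraph.order sigma a).

Definition arr_mult (a : arrow) : nat := mult (hsrc (val a)).

Definition special_power (a : arrow) : seq arrow :=
  flatten (nseq (arr_mult a) (special_cycle a)).

Definition arr_labeled (a : arrow) : bool := arr_src a \in labels B.

Definition arr_ident (a b : arrow) : bool :=
  (a == b) || (arr_src a == arr_src b) && arr_labeled a.

Lemma arr_ident_equiv : equiv_class_of arr_ident.
Proof.
rewrite /arr_ident /arr_labeled; split=> [a|a b|b a c]; first by rewrite eqxx.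
  rewrite eq_sym [arr_src b == _]eq_sym.
  by case: (eqVneq (arr_src a) (arr_src b)) => [->|].
case/orP=> [/eqP->//|/andP[/eqP-> lb]].
by case/orP=> [/eqP<-|/andP[/eqP<- _]]; rewrite eqxx lb orbT.
Qed.
Canonical arr_ident_equivRel := EquivRelPack arr_ident_equiv.

Definition larrow : choiceType := {eq_quot arr_ident}.
Definition arr_pi (a : arrow) : larrow := \pi_({eq_quot arr_ident}) a.

Definition larr_src (x : larrow) : edge B := arr_src (repr x).
Definition larr_tgt (x : larrow) : edge B := arr_tgt (repr x).
Definition QgraphL : quiver := Quiver larr_src larr_tgt edge_gt0.

Lemma arr_piP (a b : arrow) : reflect (arr_pi a = arr_pi b) (arr_ident a b).
Proof.
apply: (iffP idP) => [h|/eqmodP //]; exact/eqmodP.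
Qed.

Lemma arr_ident_tgt (a b : arrow) : arr_ident a b -> arr_tgt a = arr_tgt b.
Proof.
case/orP=> [/eqP-> //|/andP[/eqP e la]].
have := labels_labelable la; move/eqP: (e); rewrite edge_ofE.
case/orP=> /eqP eab Lb; first by rewrite /arr_tgt eab.
by rewrite /arr_tgt eab -(Lb _ (esym e)) edge_of_inv.
Qed.

Lemma larr_src_pi (a : arrow) : larr_src (arr_pi a) = arr_src a.
Proof.
have /arr_piP : arr_pi (repr (arr_pi a)) = arr_pi a by apply: reprK.
by rewrite /larr_src /arr_ident => /orP[/eqP-> //|/andP[/eqP]].
Qed.

Lemma larr_tgt_pi (a : arrow) : larr_tgt (arr_pi a) = arr_tgt a.
Proof.
by apply/arr_ident_tgt/arr_piP; apply: reprK.
Qed.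

(* The number of letters in the longest common prefix of two words; the first
   position (counted from 1) at which they differ is its successor. (The words
   below do differ, unless Gamma is a single edge and this edge is labeled.) *)
Definition common_prefix (T : eqType) (u v : seq T) : nat :=
  find (fun xy => xy.1 != xy.2) (zip u v).

(* u = [:: alpha_n; ...; alpha_1] and v = [:: beta_m; ...; beta_1]; the result
   is [:: alpha_(n - l2 + 1); ...; alpha_l1]. *)
Definition trim (T : eqType) (u v : seq T) : seq T :=
  let l1 := (common_prefix (rev u) (rev v)).+1 in
  let l2 := (common_prefix u v).+1 in
  drop l2.-1 (take (size u - l1.-1) u).

Definition pi_word (w : seq arrow) : seq (qarrow QgraphL) := map arr_pi w.

Definition edge_nontruncated (e : edge B) : Prop :=
  forall h, edge_of h = e -> ~~ truncated (hsrc h).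

Variable k : fieldType.

Inductive sf_relation : pathAlg k QgraphL -> Prop :=
| SfCycles (e : edge B) (a b : arrow) :
    edge_nontruncated e -> a != b -> arr_tgt a = e -> arr_tgt b = e ->
    sf_relation
      (word_elt k (trim (pi_word (special_power a)) (pi_word (special_power b)))
     - word_elt k (trim (pi_word (special_power b)) (pi_word (special_power a))))
| SfPower (a : arrow) :
    sf_relation (word_elt k (pi_word (special_power a ++ [:: a])))
(* The path alpha_n ... alpha_1 of Q_Gamma is an :: rcons mid a1, so that
   n - 1 = (size mid).+1; there is no such path with n = 1. *)
| SfZero (an a1 : arrow) (mid : seq arrow) :
    @is_path Qgraph (arr_tgt an) (an :: rcons mid a1) ->
    all arr_labeled mid -> ~~ arr_labeled a1 -> ~~ arr_labeled an ->
    iter (size mid).+1 sigma an != a1 ->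
    sf_relation (word_elt k (pi_word (an :: rcons mid a1))).

Definition sfAlg := quotAlg sf_relation.

Definition is_sf_brauer_graph_algebra (A : algType k) : Prop :=
  exists f : {linear A -> sfAlg}, monoid_morphism f /\ bijective f.

End Relations.

Section DeleteLabeled.
Variable G : labeledRibbonGraph.

(* If all edges are labeled, then Gamma is a single edge with two endpoints of
   valency 1, and deleting this edge leaves two vertices without half-edges:
   this is not a ribbon graph, since cycles of rho' are nonempty. In all other
   cases each vertex keeps a half-edge. *)
Hypothesis labels_neqT : labels G != [set: edge G].

Lemma unlabeled_at (v : vertex G) :
  exists2 h : halfedge G, hsrc h = v & edge_of h \notin labels G.
Proof.
have [h hv] := half_at_vert v.
case: (boolP (edge_of h \in labels G)) => [hL|hL]; last by exists h.
case: (leqP 2 (valency v)) => [/labels_val v2|v1].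
  have /card_gt0P[g] := ltn_trans (ltn0Sn 0) v2.
  by rewrite !inE => /andP[/eqP gv gL]; exists g.
have atv g : hsrc g = v -> g = h.
  move=> gv; have /eqP/cards1P[x ex] : valency v = 1%N.
    apply/eqP; rewrite eqn_leq -ltnS v1 /=; apply/card_gt0P.
    by exists h; rewrite inE hv.
  have : g \in halves_at v by rewrite inE gv.
  have : h \in halves_at v by rewrite inE hv.
  by rewrite ex !inE => /eqP-> /eqP->.
have rh : hrot G h = h by apply: atv; rewrite hsrc_rot.
have rih : hrot G (hinv h) = hinv h.
  by have := labels_labelable hL erefl; rewrite rh => <-.
have atw g : hsrc g = hsrc (hinv h) -> g = hinv h.
  move/eqP; rewrite -hsrc_porbit => /porbitP[n ->]; rewrite permX.
  by elim: n => //= n ->.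
have reach x : x = v \/ x = hsrc (hinv h).
  have /connectP[p pp ->] : connect (@adjacent G) v x by apply: (lrg_connected G).2.
  elim/last_ind: p pp => [|p y IH]; first by left.
  rewrite rcons_path last_rcons => /andP[/IH lp /existsP[g /andP[/eqP gl /eqP <-]]].
  case: lp => e; rewrite e in gl; first by rewrite (atv g gl); right.
  by rewrite (atw g gl) hinvK; left.
case/negP: labels_neqT; apply/eqP/setP => e; rewrite !inE.
have [g <-] := edge_ofP e.
by have [/atv ->|/atw ->] := reach (hsrc g); rewrite ?edge_of_inv.
Qed.

Definition unlabeled : finType :=
  {h : halfedge G | edge_of h \notin labels G}.
Implicit Types h g : unlabeled.

Lemma del_inv_subproof h : edge_of (hinv (val h)) \notin labels G.
Proof. by rewrite edge_of_inv; apply: (valP h). Qed.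
Definition del_inv h : unlabeled :=
  exist (fun x => edge_of x \notin labels G) _ (del_inv_subproof h).

Lemma return_ex h :
  exists i, (0 < i)%N && (edge_of (iter i (hrot G) (val h)) \notin labels G).
Proof.
exists #[hrot G]%g; rewrite order_gt0 -permX expg_order perm1.
exact: (valP h).
Qed.

Definition return_time h : nat := ex_minn (return_ex h).

Lemma return_subproof h :
  edge_of (iter (return_time h) (hrot G) (val h)) \notin labels G.
Proof. by rewrite /return_time; case: ex_minnP => i /andP[]. Qed.

Lemma return_gt0 h : (0 < return_time h)%N.
Proof. by rewrite /return_time; case: ex_minnP => i /andP[]. Qed.

Lemma return_min h j : (0 < j)%N ->
  edge_of (iter j (hrot G) (val h)) \notin labels G -> (return_time h <= j)%N.
Proof.
by move=> j0 jL; rewrite /return_time; case: ex_minnP => i _; apply; rewrite j0.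
Qed.

Definition del_rot_fun h : unlabeled :=
  exist (fun x => edge_of x \notin labels G) _ (return_subproof h).

Lemma del_rot_inj : injective del_rot_fun.
Proof.
have wl h g : (return_time h <= return_time g)%N ->
    del_rot_fun h = del_rot_fun g -> h = g.
  move=> le /(congr1 val) /=; rewrite -(subnKC le) iterD.
  rewrite -!permX => /perm_inj; rewrite permX => e.
  case: (posnP (return_time g - return_time h)) => [z|p].
    by apply: val_inj; rewrite /= e z.
  have := @return_min g _ p; rewrite -e => /(_ (valP h)).
  by rewrite leqNgt ltn_subrL return_gt0 (leq_trans (return_gt0 h) le).
move=> h g e; case: (leqP (return_time h) (return_time g)) => [le|/ltnW le].
  exact: wl.
by apply/esym/wl.
Qed.

Definition del_rot : {perm unlabeled} := perm del_rot_inj.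

Definition del_src h : vertex G := hsrc (val h).

Lemma del_invK : involutive del_inv.
Proof. by move=> h; apply: val_inj; rewrite /= hinvK. Qed.

Lemma del_inv_neq h : del_inv h != h.
Proof. by rewrite -val_eqE /= hinv_neq. Qed.

Lemma del_src_rot h : del_src (del_rot h) = del_src h.
Proof.
by rewrite permE /del_src /=; elim: (return_time h) => //= n; rewrite hsrc_rot.
Qed.

Lemma del_reach n h g : val g = iter n (hrot G) (val h) ->
  g \in porbit del_rot h.
Proof.
elim/ltn_ind: n h => n IH h e; case: (posnP n) => [z|n0].
  suff -> : g = h by apply: porbit_id.
  by apply: val_inj; rewrite e z.
have le : (return_time h <= n)%N by apply: return_min => //; rewrite -e (valP g).
have lt : (n - return_time h < n)%N by rewrite ltn_subrL return_gt0 n0.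
have : g \in porbit del_rot (del_rot h).
  by apply: (IH _ lt); rewrite permE /= -iterD subnK.
by rewrite -(porbit_perm del_rot 1 h) expg1.
Qed.

Lemma del_rotP : porbits del_rot = [set del_src @^-1: [set v] | v : vertex G].
Proof.
have orb h : porbit del_rot h = del_src @^-1: [set del_src h].
  apply/setP => g; rewrite !inE; apply/idP/idP => [/porbitP[n ->]|].
    by rewrite permX; elim: n => //= n; rewrite del_src_rot.
  rewrite -hsrc_porbit => /porbitP[n e]; apply: (@del_reach n).
  by rewrite e permX.
apply/setP => X; apply/imsetP/imsetP => [[h _ ->]|[v _ ->]].
  by exists (del_src h).
have [h hv hL] := unlabeled_at v.
by exists (exist _ h hL) => //; rewrite orb /del_src /= hv.
Qed.

Definition delete_labeled : ribbonGraph :=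
  RibbonGraph del_invK del_inv_neq del_rotP.

End DeleteLabeled.

(* Main.v *)
From HB Require Import structures.
From mathcomp Require Import all_boot all_order all_fingroup all_algebra.
From mathcomp Require Import generic_quotient boolp.
Require Import Defs.

(** Suppose that (Gamma \ L, m) is not a Brauer tree. The graph Gamma \ L is always
connected: turning from a labeled edge to the next half-edge yields a parallel
edge, so that after finitely many turns an unlabeled parallel edge is reached.
Hence Gamma \ L contains a cycle, or it has two vertices of multiplicity at
least 2, which a simple path joins. In both cases the half-edges on the cycle,
resp. on the path, form a nonempty set C that is closed under the involution,
contains no labeled half-edge, has at most two elements at each vertex, and has
exactly one element only at vertices of multiplicity at least 2.

Such a set C yields indecomposable modules of arbitrarily large dimension. At a
vertex, rotating from one element c of C to the next one (which is c itself
after a full turn, when there is no other one) gives a path in the quiver, a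
segment. Crossing an edge of C and then passing to the other half-edge of C at
the vertex reached, again and again, one obtains an endless walk along C. The
segments at the vertices of this walk are oriented alternately, so that the
edges in even position are sources and those in odd position are sinks, and a
finite stretch of this zigzag carries a string module (lemma stroll_module):
a representation having a basis on which the arrows act by partial maps.

On such a module a word of arrows acts nontrivially only if it is a contiguous
part of a segment (walk_sub_piece), and this makes all relations vanish, term by
term. A segment contains fewer unlabeled arrows than the power of the special
cycle, since it stops before a full turn or else the multiplicity is at least 2
(segment_count); on the other hand trimming removes only labeled arrows
(trim_special_count), so neither a trimmed power of a special cycle nor the
longer word in the second relation fits in a segment. The zero paths of the
third relation do not fit either, because a segment follows the rotation.

An idempotent endomorphism has a constant matrix along the diagonals of the block
indexed by the sources, because the source i and the source i + 1 are mapped onto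
a common sink; as the zigzag both begins and ends with a source, the entries off
the main diagonal are zero, and the idempotent is 0 or 1 (zigzag_idempotent).
Finally, finitely many modules cannot account for indecomposables of unbounded
dimension (unbounded_infinite_type). *)

Set Implicit Arguments.
Unset Strict Implicit.
Unset Printing Implicit Defensive.

Import GRing.Theory.
Local Open Scope ring_scope.

(** * Representations of a quiver by partial maps of a basis *)

Section BasisVectors.
Variables (k : fieldType) (Y : finType).
Local Notation W := {ffun Y -> k^o}.
Implicit Types m : W.

Definition delta (y : Y) : W := [ffun z => (z == y)%:R].
Definition odelta (o : option Y) : W := oapp delta 0 o.

Lemma deltaE y z : delta y z = (z == y)%:R.
Proof. by rewrite ffunE. Qed.

Lemma sum_delta m : m = \sum_y m y *: delta y.
Proof.
apply/ffunP => z; rewrite sum_ffunE (bigD1 z) //= big1 => [|y ny].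
  by rewrite addr0 ffunE deltaE eqxx /GRing.scale /= mulr1.
by rewrite ffunE deltaE eq_sym (negPf ny) /GRing.scale /= mulr0.
Qed.

Lemma delta_sum (V : lmodType k) (g : Y -> V) y : \sum_z delta y z *: g z = g y.
Proof.
rewrite (bigD1 y) //= big1 => [|z nz]; first by rewrite deltaE eqxx scale1r addr0.
by rewrite deltaE (negPf nz) scale0r.
Qed.

Lemma delta_lin_eq (V : lmodType k) (f g : W -> V) :
  linear f -> linear g -> (forall y, f (delta y) = g (delta y)) -> f =1 g.
Proof.
move=> lf lg e m.
pose F : {linear _ -> _} := HB.pack f (GRing.isLinear.Build _ _ _ _ f lf).
pose G : {linear _ -> _} := HB.pack g (GRing.isLinear.Build _ _ _ _ g lg).
rewrite -[f]/(F : _ -> _) -[g]/(G : _ -> _) [m]sum_delta !linear_sum.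
by apply: eq_bigr => y _; rewrite !linearZ /= e.
Qed.

End BasisVectors.

Lemma path_lin_eq (k : fieldType) (Q : quiver) (V : lmodType k)
    (f g : pathAlg k Q -> V) :
  linear f -> linear g ->
  (forall p, f (path_elt k p) = g (path_elt k p)) -> f =1 g.
Proof.
move=> lf lg e; apply: (@malg_lin_eq k _ V f g) => // p.
by rewrite -path_eltE.
Qed.

(** Representations in which every arrow maps each basis vector to a basis vector
or to zero: such a representation is a partial map [step a] for every arrow [a]. *)
Section MonomialAction.
Variables (k : fieldType) (Q : quiver) (Y : finType).
Variables (vert : Y -> qvert Q) (step : qarrow Q -> Y -> option Y).
Hypothesis step_vert : forall a y z,
  step a y = Some z -> vert y = qsrc a /\ vert z = qtgt a.
Local Notation W := {ffun Y -> k^o}.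
Implicit Types (y z : Y) (w : seq (qarrow Q)) (p q : qpath Q) (m : W).
Implicit Types b c : pathAlg k Q.

(** Words are read from right to left, like paths. *)
Definition walk w y : option Y := foldr (fun a => obind (step a)) (Some y) w.

Definition pwalk p y : option Y :=
  if vert y == psrc p then walk (pword p) y else None.

Definition act b m : W := \sum_y m y *: lin_ext (fun p => odelta k (pwalk p y)) b.

Lemma walk_cat w1 w2 y : walk (w1 ++ w2) y = obind (walk w1) (walk w2 y).
Proof.
by elim: w1 => [|a w1 IH] /=; [case: walk | rewrite IH; case: (walk w2 y)].
Qed.

Lemma walk_tgt t w y z :
  is_path t w -> vert y = last t (map (@qsrc Q) w) -> walk w y = Some z ->
  vert z = t.
Proof.
elim: w t z => [|a w IH] t z /=; first by move=> _ <- [->].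
case/andP=> /eqP <- _ _; case: (walk w y) => //= x /step_vert[_ ->] //.
Qed.

Lemma pwalk_comp p q y :
  obind (pwalk p) (pwalk q y) = if pcomp p q is Some r then pwalk r y else None.
Proof.
have tq z : pwalk q y = Some z -> vert z = ptgt q.
  rewrite /pwalk; case: eqP => // e; apply: walk_tgt e; exact: (pvalP q).
case: (eqVneq (psrc p) (ptgt q)) => [e|n]; last first.
  rewrite pcomp_None //; case E: (pwalk q y) => [z|] //=.
  by rewrite /pwalk (tq _ E) eq_sym (negPf n).
have [r Er vr] := pcompE e; rewrite Er.
case E: (pwalk q y) => [z|] /=; last first.
  move: E; rewrite /pwalk (pcomp_src Er); case: eqP => // _ E.
  by rewrite /pword vr walk_cat -/(pword q) E.
rewrite {1}/pwalk (tq _ E) e eqxx; move: E; rewrite /pwalk (pcomp_src Er).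
by case: eqP => // _ E; rewrite /pword vr walk_cat -/(pword q) E.
Qed.

Lemma act_deltaE b y :
  act b (delta k y) = lin_ext (fun p => odelta k (pwalk p y)) b.
Proof. exact: delta_sum. Qed.

Lemma act_is_linear b : linear (act b).
Proof.
move=> c m1 m2; rewrite /act scaler_sumr -big_split /=; apply: eq_bigr => y _.
by rewrite !ffunE scalerDl scalerA.
Qed.

Lemma act_linearl m : linear (act^~ m).
Proof.
move=> c b1 b2; rewrite /act scaler_sumr -big_split /=; apply: eq_bigr => y _.
by rewrite linearP scalerDr !scalerA mulrC.
Qed.

HB.instance Definition _ b := GRing.isLinear.Build k W W _ (act b) (act_is_linear b).

Lemma act_path p y : act (path_elt k p) (delta k y) = odelta k (pwalk p y).
Proof. by rewrite act_deltaE path_elt.unlock lin_extU. Qed.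

Lemma actDl b c m : act (b + c) m = act b m + act c m.
Proof. by have := act_linearl m 1 b c; rewrite !scale1r. Qed.

Lemma act0l m : act 0 m = 0.
Proof. by have := act_linearl m (-1) 0 0; rewrite scaler0 addr0 scaleN1r addNr. Qed.

Lemma actNl b m : act (- b) m = - act b m.
Proof. by apply/eqP; rewrite -subr_eq0 opprK -actDl addNr act0l. Qed.

Lemma actZl (a : k) b m : act (a *: b) m = a *: act b m.
Proof. by have := act_linearl m a b 0; rewrite act0l !addr0. Qed.

Lemma act_sum (I : Type) (r : seq I) (F : I -> pathAlg k Q) m :
  act (\sum_(i <- r) F i) m = \sum_(i <- r) act (F i) m.
Proof.
by elim/big_rec2: _ => [|i x y _ <-]; rewrite ?act0l ?actDl.
Qed.

(** By bilinearity it suffices to compare paths on basis vectors, where the claim is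
that concatenated paths act by the composite partial map. *)
Lemma act_mul b c m : act (b * c) m = act b (act c m).
Proof.
apply: (delta_lin_eq (f := act (b * c)) (g := fun m => act b (act c m))).
- exact: act_is_linear.
- by move=> a x z; rewrite !linearP.
move=> y.
apply: (path_lin_eq (f := fun b => act (b * c) (delta k y))
          (g := fun b => act b (act c (delta k y)))) => [a x z|a x z|p].
- by rewrite mulrDl -scalerAl act_linearl.
- exact: act_linearl.
apply: (path_lin_eq (f := fun c => act ((path_elt k p : pathAlg k Q) * c) (delta k y))
          (g := fun c => act (path_elt k p) (act c (delta k y)))) => [a x z|a x z|q].
- by rewrite mulrDr -scalerAr act_linearl.
- by rewrite act_linearl linearP.
rewrite path_eltM act_path /pcomp_elt.
have := pwalk_comp p q y; case: (pcomp p q) => [r|] e; case E: (pwalk q y) e => [z|] /= e.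
- by rewrite !act_path -e.
- by rewrite !act_path linear0 -e.
- by rewrite !act_path act0l e.
- by rewrite act0l linear0.
Qed.

Lemma act_one m : act 1 m = m.
Proof.
apply: (delta_lin_eq (f := act 1) (g := id)) => // [|y].
  exact: act_is_linear.
rewrite -[1]/(pa_one k Q) /pa_one act_sum (bigD1 (vert y)) //= big1 => [|v nv].
  by rewrite act_path /pwalk eqxx addr0.
by rewrite act_path /pwalk eq_sym (negPf nv).
Qed.

(** The vertex condition built into the action of a path is automatic for an arrow,
as [step] is defined only at the source of the arrow; hence words act by [walk]
without reference to vertices. *)
Lemma act_arrow a y : act (arrow_elt k a) (delta k y) = odelta k (step a y).
Proof.
rewrite act_path /pwalk /psrc /=; case: eqP => // ne.
by case E: step => [z|] //; case: ne; have [] := step_vert E.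
Qed.

Lemma act_word w y : act (word_elt k w) (delta k y) = odelta k (walk w y).
Proof.
elim: w => [|a w IH] /=; first by rewrite /word_elt big_nil act_one.
rewrite /word_elt big_cons act_mul IH; case: (walk w y) => [z|] /=.
  exact: act_arrow.
exact: linear0.
Qed.

End MonomialAction.

(** * Restriction of scalars along an isomorphism with a quotient algebra *)

Section QuotientModule.
Variables (k : fieldType) (A C : algType k) (S : C -> Prop).
Variables (f : {linear A -> quotAlg S}) (W : lmodType k) (act : C -> W -> W).
Hypotheses (fM : monoid_morphism f) (fB : bijective f).
Hypotheses (act_additive : forall b m n, act b (m + n) = act b m + act b n)
  (actDl : forall b c m, act (b + c) m = act b m + act c m)
  (actM : forall b c m, act (b * c) m = act b (act c m))
  (actZ1 : forall (a : k) m, act (a *: 1) m = a *: m)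
  (act_rel : forall b m, S b -> act b m = 0).

Lemma quotient_act0 b : act b 0 = 0.
Proof. by apply: (addrI (act b 0)); rewrite -act_additive !addr0. Qed.

Lemma quotient_act0l m : act 0 m = 0.
Proof. by apply: (addrI (act 0 m)); rewrite -actDl !addr0. Qed.

Lemma quotient_act_ideal b m : ideal_gen S b -> act b m = 0.
Proof.
case=> l Sl ->; elim: l Sl => [|t l IH] Sl; first by rewrite big_nil quotient_act0l.
rewrite big_cons actDl IH => [|u ul]; last by apply: Sl; rewrite inE ul orbT.
by rewrite !actM (act_rel _ (Sl t _)) ?mem_head // quotient_act0 addr0.
Qed.

Lemma quotient_act_eq b c m : qpi S b = qpi S c -> act b m = act c m.
Proof.
move=> /qpi_eq/(quotient_act_ideal m) e.
by rewrite -[b](subrK c) actDl e add0r.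
Qed.

Let lift (a : A) : C := repr (f a).

Let lift_eq (a : A) b m : f a = qpi S b -> act (lift a) m = act b m.
Proof. by move=> e; apply: quotient_act_eq; rewrite qpi_repr. Qed.

(** An action killing the defining relations descends to the quotient. The carrier of
the resulting module is W itself; [j] only hides which structure is meant, since
W is also a vector space over k. *)
Lemma quotient_module : exists (M : lmodType A) (j : W -> M),
  [/\ bijective j, {morph j : m n / m + n},
      forall b, exists a : A, forall m, a *: j m = j (act b m),
      forall a : A, exists b, forall m, a *: j m = j (act b m) &
      forall (c : k) m, (c *: 1 : A) *: j m = j (c *: m)].
Proof.
have scaleA a b m : act (lift a) (act (lift b) m) = act (lift (a * b)) m.
  rewrite -actM; apply/esym/lift_eq; rewrite fM.2.
  by rewrite -[f a in LHS]qpi_repr -[f b in LHS]qpi_repr -quot_mulE.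
have f1 : f 1 = qpi S 1 by rewrite fM.1.
have scale1 m : act (lift 1) m = m by rewrite (lift_eq _ f1) -[1]scale1r actZ1 scale1r.
have scaleDl m : {morph (fun a => act (lift a) m) : a b / a + b}.
  move=> a b; rewrite -actDl; apply: lift_eq.
  by rewrite linearD -[f a in LHS]qpi_repr -[f b in LHS]qpi_repr -qpiD.
have scaleDr : right_distributive (fun a => act (lift a)) +%R.
  by move=> a m n; exact: act_additive.
pose M : lmodType A := HB.pack_for (lmodType A) (W : Type)
  (GRing.Zmodule.on W)
  (GRing.Zmodule_isLmodule.Build A W scaleA scale1 scaleDr scaleDl).
exists M, (fun m => m); split=> //; first by exists id.
- move=> b; have [g _ gK] := fB; exists (g (qpi S b)) => m.
  by apply: lift_eq; rewrite gK.
- by move=> a; exists (lift a).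
move=> c m; rewrite -[RHS]actZ1; apply: lift_eq.
by rewrite linearZ /= f1 -quot_scaleE.
Qed.

End QuotientModule.

(** * Unbounded dimension of indecomposables *)

Section InfiniteType.
Variables (k : fieldType) (A : algType k).

(** Dimension over k, where k acts through the multiples of the unit of A: an
A-module carries no other k-structure. *)
Definition has_basis (M : lmodType A) (Y : finType) : Prop :=
  exists j : {ffun Y -> k^o} -> M,
    [/\ bijective j, {morph j : m n / m + n} &
        forall c m, (c *: 1 : A) *: j m = j (c *: m)].

Lemma has_basis_iso (M N : lmodType A) (Y : finType) :
  lmod_iso M N -> has_basis M Y -> has_basis N Y.
Proof.
case=> g gB [j [jB jD jZ]]; exists (g \o j); split; first exact: bij_comp.
  by move=> m n /=; rewrite jD linearD.
by move=> c m /=; rewrite -jZ linearZ.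
Qed.

Lemma has_basis_leq (M : lmodType A) (Y Z : finType) :
  has_basis M Y -> has_basis M Z -> (#|Y| <= #|Z|)%N.
Proof.
case=> i [[i' iK i'K] iD iZ] [j [[j' jK j'K] jD jZ]].
have hl : linear (j' \o i).
  move=> c m n /=; apply: (can_inj jK).
  by rewrite jD -jZ !j'K iD -iZ.
pose h : {linear {ffun Y -> k^o} -> {ffun Z -> k^o}} :=
  HB.pack (j' \o i) (GRing.isLinear.Build _ _ _ _ _ hl).
have hI : injective (linfun h).
  by move=> m n; rewrite !lfunE /= => /(can_inj j'K)/(can_inj iK).
have /eqP ker0 : lker (linfun h) == 0%VS by apply/lker0P.
have := limg_ker_dim (linfun h) fullv; rewrite ker0 capv0 dimv0 add0n => e.
have := dimvS (subvf (linfun h @: fullv)); rewrite e !dimvf.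
by rewrite /dim /= !muln1.
Qed.

(** An indecomposable whose dimension exceeds all dimensions occurring in a finite
list of modules is isomorphic to none of them. *)
Lemma unbounded_infinite_type :
  (forall N, exists M : lmodType A,
     [/\ finitely_generated M, indecomposable M &
         exists2 Y : finType, (N < #|Y|)%N & has_basis M Y]) ->
  ~ finite_representation_type A.
Proof.
move=> unb [n [L HL]].
have /choice[D HD] (i : 'I_n) : exists d : nat, forall Y, has_basis (L i) Y ->
    (#|Y| <= d)%N.
  have [[Y LY]|no] := pselect (exists Y, has_basis (L i) Y).
    by exists #|Y| => Z LZ; exact: has_basis_leq LZ LY.
  by exists 0%N => Z LZ; case: no; exists Z.
have [M [Mfg Mind [Y ltY MY]]] := unb (\max_i D i).
have [i Mi] := HL M Mfg Mind.
have := HD i Y (has_basis_iso Mi MY).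
by rewrite leqNgt (leq_ltn_trans _ ltY) // leq_bigmax.
Qed.

End InfiniteType.

(** * Zigzag modules *)

(** A zigzag has n + 2 tops 0, ..., n + 1 and n + 1 socles 0, ..., n. The piece
(i, false) is a path from the top i to the socle i, and the piece (i, true) is a
path from the top i + 1 to the socle i. *)
Section Zigzag.
Variables (Q : quiver) (a0 : qarrow Q) (n : nat).
Local Notation piece := ('I_n.+1 * bool)%type.
Variables (u : piece -> seq (qarrow Q)).
Variables (xtop : 'I_n.+2 -> qvert Q) (xsoc : 'I_n.+1 -> qvert Q).

Definition piece_top (r : piece) : 'I_n.+2 := inord (r.1 + r.2).

Local Notation letter r e := (nth a0 (u r) e).

Hypothesis u_gt0 : forall r, (0 < size (u r))%N.
Hypothesis u_path : forall r e, (e.+1 < size (u r))%N ->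
  qsrc (letter r e) = qtgt (letter r e.+1).
Hypothesis u_tgt : forall r, qtgt (letter r 0) = xsoc r.1.
Hypothesis u_src : forall r, qsrc (letter r (size (u r)).-1) = xtop (piece_top r).
(** The arrow leaving a top determines the piece as a word and its direction; it does
not occur again inside a piece. *)
Hypothesis u_first : forall r r' e, (e < size (u r'))%N ->
  letter r' e = letter r (size (u r)).-1 ->
  [/\ u r' = u r, r'.2 = r.2 & e = (size (u r')).-1].
(** The zigzag may return to a vertex. It then continues with the same words, so the
tops over one vertex cannot be told apart by the words leaving them. *)
Hypothesis u_top : forall r r', r.2 = r'.2 ->
  xtop (piece_top r) = xtop (piece_top r') -> u r = u r'.
Hypothesis u_mid : forall r e j, (e.+1 < size (u r))%N -> qsrc (letter r e) <> xtop j.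

(** The last summand collects the interior points of the pieces: the element [o] of
the piece [r] is the point from which [o.+1] arrows remain to be traversed. *)
Definition node_type : finType :=
  ('I_n.+2 + 'I_n.+1 + {r : piece & 'I_(size (u r)).-1})%type.

Definition top (j : 'I_n.+2) : node_type := inl (inl j).
Definition soc (i : 'I_n.+1) : node_type := inl (inr i).
Definition mid (r : piece) (o : 'I_(size (u r)).-1) : node_type :=
  inr (Tagged (fun r => 'I_(size (u r)).-1) o).

(** The point of the piece [r] from which [e] arrows remain to be traversed; the cases
[e = 0] and [e = size (u r)] give the endpoints, which adjacent pieces share. *)
Definition node (r : piece) (e : nat) : node_type :=
  if e is e'.+1 then if insub e' is Some o then @mid r o else top (piece_top r)
  else soc r.1.

Arguments node : simpl never.

Definition node_vert (y : node_type) : qvert Q :=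
  match y with
  | inl (inl j) => xtop j
  | inl (inr i) => xsoc i
  | inr s => qsrc (letter (tag s) (tagged s))
  end.

(** A non-dependent view of interior points, from which equations can be read off. *)
Definition mid_data (y : node_type) : option (piece * nat) :=
  if y is inr s then Some (tag s, nat_of_ord (tagged s)) else None.

Lemma node_top r : node r (size (u r)) = top (piece_top r).
Proof.
rewrite -(ltn_predK (u_gt0 r)) /node; case: insubP => // o.
by rewrite ltnn.
Qed.

Lemma node_mid r e : (e.+1 < size (u r))%N ->
  exists2 o : 'I_(size (u r)).-1, node r e.+1 = @mid r o & val o = e.
Proof.
move=> lt; rewrite /node; case: insubP => [o _ eo|]; first by exists o.
by rewrite -ltnS (ltn_predK lt) lt.
Qed.

Lemma node_data r e : (e.+1 < size (u r))%N ->
  mid_data (node r e.+1) = Some (r, e).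
Proof. by move=> lt; have [o -> <-] := node_mid lt. Qed.

Lemma node_inj r r' e e' : (0 < e < size (u r))%N -> (e' <= size (u r'))%N ->
  node r e = node r' e' -> r = r' /\ e = e'.
Proof.
case: e => // e /= lt le E; have := node_data lt; rewrite E.
case: e' le {E} => // e'; rewrite leq_eqVlt => /orP[/eqP->|lt'].
  by rewrite node_top.
by rewrite (node_data lt') => -[-> ->].
Qed.

Lemma node_topI r e j : (e <= size (u r))%N -> node r e = top j ->
  e = size (u r) /\ j = piece_top r.
Proof.
rewrite leq_eqVlt => /orP[/eqP->|lt]; first by rewrite node_top => -[].
by case: e lt => // e lt; have [o ->] := node_mid lt.
Qed.

Lemma node_socI r e i : (e <= size (u r))%N -> node r e = soc i ->
  e = 0%N /\ i = r.1.
Proof.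
rewrite leq_eqVlt => /orP[/eqP->|lt]; first by rewrite node_top.
case: e lt => [|e] lt; first by case.
by have [o ->] := node_mid lt.
Qed.

Lemma node_vertS r e : (e < size (u r))%N ->
  node_vert (node r e.+1) = qsrc (letter r e).
Proof.
rewrite leq_eqVlt => /orP[/eqP E|lt]; first by rewrite E node_top /= -u_src -E.
by have [o -> /= <-] := node_mid lt.
Qed.

Lemma node_vertE r e : (e < size (u r))%N ->
  node_vert (node r e) = qtgt (letter r e).
Proof.
case: e => [|e] lt; first by rewrite u_tgt.
by rewrite node_vertS ?u_path // ltnW.
Qed.

Definition node_rel a y z := [exists r : piece, exists e : 'I_(size (u r)),
  [&& a == letter r e, y == node r e.+1 & z == node r e]].

Lemma node_relP a y z : reflect
  (exists r e, [/\ (e < size (u r))%N, a = letter r e, y = node r e.+1 & z = node r e])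
  (node_rel a y z).
Proof.
apply: (iffP existsP) => [[r /existsP[e /and3P[/eqP-> /eqP-> /eqP->]]]|].
  by exists r, e.
case=> r [e [lt -> -> ->]]; exists r; apply/existsP; exists (Ordinal lt).
by rewrite /= !eqxx.
Qed.

Definition zstep a y : option node_type := [pick z | node_rel a y z].

Lemma zstepP a y z : zstep a y = Some z ->
  exists r e, [/\ (e < size (u r))%N, a = letter r e, y = node r e.+1 & z = node r e].
Proof. by rewrite /zstep; case: pickP => // x /node_relP + [<-]. Qed.

Lemma zstep_vert a y z :
  zstep a y = Some z -> node_vert y = qsrc a /\ node_vert z = qtgt a.
Proof.
by case/zstepP=> r [e [lt -> -> ->]]; rewrite node_vertS ?node_vertE.
Qed.

Lemma piece_top_val r : val (piece_top r) = (r.1 + r.2)%N.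
Proof.
by rewrite /= inordK //; have := leq_add (ltn_ord r.1) (leq_b1 r.2); rewrite addn1.
Qed.

Lemma piece_eq (r r' : piece) : r.2 = r'.2 -> piece_top r = piece_top r' -> r = r'.
Proof.
move=> e2 /(congr1 val); rewrite !piece_top_val.
by case: r r' e2 => [i b] [i' b'] /= <- /addIn/val_inj->.
Qed.

(** The choice in [zstep] is forced: interior points lie on one piece only, and the
two pieces leaving a top start with different arrows by [u_first]. *)
Lemma zstep_node r e : (e < size (u r))%N ->
  zstep (letter r e) (node r e.+1) = Some (node r e).
Proof.
move=> lt; rewrite /zstep; case: pickP => [z|no]; last first.
  by have /negP[] := negbT (no (node r e)); apply/node_relP; exists r, e.
case/node_relP=> r' [e' [lt' El En ->]]; congr Some.
move: (lt); rewrite leq_eqVlt => /orP[/eqP E|lt2]; last first.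
  by have [//|<- [<-]] := node_inj _ lt' En.
move: En; rewrite {1}E node_top => /esym/(node_topI lt')[E' Et].
have := u_first (r := r') lt; rewrite El -E' => /(_ erefl)[_ e2 _].
by rewrite -(piece_eq e2 Et) in lt' E' *; move: E; rewrite -E' => -[->].
Qed.

Local Notation zwalk := (walk zstep).

(** Distinct pieces meet only in tops, which no arrow reaches, and in socles, which no
arrow leaves; so a walk cannot change from one piece to another. *)
Lemma walk_sub_piece w y z : zwalk w y = Some z -> w != [::] ->
  exists r e, [/\ (e + size w <= size (u r))%N, y = node r (e + size w),
                  z = node r e & w = take (size w) (drop e (u r))].
Proof.
elim: w z => // a w IH z /=; case E: (zwalk w y) => [x|] //= /zstepP[r [e [lt -> ex ->]]] _.
case: (eqVneq w [::]) => [w0|wn].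
  move: E; rewrite w0 /= => -[->]; exists r, e.
  by rewrite /= addn1 -ex (drop_nth a0 lt) /= take0.
have [r' [e' [le Ey Ex Ew]]] := IH _ E wn.
have lt' : (e' < size (u r'))%N.
  by rewrite (leq_trans _ le) // -[X in (X < _)%N]addn0 ltn_add2l lt0n size_eq0.
have [||rr ee] := @node_inj r' r e' e.+1 _ lt; last 1 first.
- subst r' e'; exists r, e; rewrite addnS -addSn; split=> //.
  by rewrite (drop_nth a0 lt) /= -Ew.
- rewrite lt' andbT lt0n; apply/eqP=> e0.
  by move: Ex; rewrite e0 ex => /node_socI[].
- by rewrite -Ex ex.
Qed.

Lemma walk_infix w y z : zwalk w y = Some z -> w != [::] ->
  exists r, infix w (u r).
Proof.
move=> E wn; have [r' [e [_ _ _ ->]]] := walk_sub_piece E wn.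
exists r'; apply/infixP; exists (take e (u r')), (drop (size w) (drop e (u r'))).
by rewrite !cat_take_drop.
Qed.

Lemma walk_drop r e : (e <= size (u r))%N ->
  zwalk (drop e (u r)) (top (piece_top r)) = Some (node r e).
Proof.
move=> le; rewrite -(subKn le); move: (leq_subr e (size (u r))).
elim: (size (u r) - e)%N => [|d IH] led; first by rewrite subn0 drop_size node_top.
have lt : (size (u r) - d.+1 < size (u r))%N by rewrite ltn_subrL u_gt0.
rewrite (drop_nth a0) //= subnSK // IH ?(ltnW led) //=.
by have := zstep_node lt; rewrite subnSK.
Qed.

Lemma walk_piece r : zwalk (u r) (top (piece_top r)) = Some (soc r.1).
Proof. by have := @walk_drop r 0 (leq0n _); rewrite drop0. Qed.

(** The word of a piece acts nontrivially only on the tops where it starts, since its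
first arrow occurs nowhere else. *)
Lemma walk_pieceI r y z : zwalk (u r) y = Some z ->
  exists r', [/\ u r' = u r, r'.2 = r.2, y = top (piece_top r') & z = soc r'.1].
Proof.
move=> E; have un : u r != [::] by rewrite -size_eq0 -lt0n.
have [r' [e [le Ey Ez Eu]]] := walk_sub_piece E un; exists r'.
have lt : (e + (size (u r)).-1 < size (u r'))%N.
  by rewrite (leq_trans _ le) // ltn_add2l ltn_predL.
have [|E1 E2 E3] := @u_first r r' _ lt.
  by rewrite {2}Eu nth_take ?ltn_predL // nth_drop.
have e0 : e = 0%N by apply/eqP; move/eqP: E3; rewrite E1 -{2}[_.-1]add0n eqn_add2r.
by rewrite e0 in Ey Ez; rewrite Ey -E1 node_top.
Qed.

Variable k : fieldType.
Local Notation W := {ffun node_type -> k^o}.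
Local Notation zact := (@act k Q node_type node_vert zstep).
Implicit Types m : W.

Lemma zact_delta_word w y : zact (word_elt k w) (delta k y) = odelta k (zwalk w y).
Proof. exact: act_word zstep_vert _ _. Qed.

(** Together with [act_piece_other]: the word of a piece acts as the partial bijection
from the tops at which this word starts to the corresponding socles. *)
Lemma act_piece_soc r i m : u (i, r.2) = u r ->
  zact (word_elt k (u r)) m (soc i) = m (top (piece_top (i, r.2))).
Proof.
move=> ui; pose ev y : W -> k^o := fun m => m y.
have ev_lin y : linear (ev y) by move=> c m1 m2; rewrite /ev !ffunE.
apply: (delta_lin_eq (f := fun m => ev (soc i) (zact (word_elt k (u r)) m))
          (g := ev (top (piece_top (i, r.2))))) => // [c m1 m2|y].
  by rewrite act_is_linear ev_lin.
rewrite /ev zact_delta_word deltaE; case: eqP => [<-|ne].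
  by rewrite -ui walk_piece /= deltaE eqxx.
case E: zwalk => [z|] /=; last by rewrite ffunE.
have [r' [_ e2 Ey ->]] := walk_pieceI E; rewrite deltaE.
case: eqP => // -[ei]; case: ne; rewrite Ey; congr (top (piece_top _)).
by rewrite -e2 ei; case: (r').
Qed.

Lemma act_piece_other r m y :
  (forall i, y = soc i -> u (i, r.2) <> u r) -> zact (word_elt k (u r)) m y = 0.
Proof.
move=> ny; pose ev : W -> k^o := fun m => m y.
have ev_lin : linear ev by move=> c m1 m2; rewrite /ev !ffunE.
apply: (delta_lin_eq (f := fun m => ev (zact (word_elt k (u r)) m))
          (g := fun=> 0)) => // [c m1 m2|c m1 m2|x].
- by rewrite act_is_linear ev_lin.
- by rewrite scaler0 addr0.
rewrite /ev zact_delta_word; case E: zwalk => [z|] /=; last by rewrite ffunE.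
have [r' [ur e2 _ Ez]] := walk_pieceI E; rewrite deltaE.
case: eqP => // ey; case: (ny r'.1); first by rewrite ey.
by rewrite -e2 -ur; case: (r').
Qed.

Section Endomorphism.
Variable phi : W -> W.
Hypothesis phi_add : {morph phi : m1 m2 / m1 + m2}.
Hypothesis phi_act : forall b m, phi (zact b m) = zact b (phi m).

Lemma endo_linear : linear phi.
Proof.
move=> c m1 m2; rewrite phi_add; congr (_ + _).
have e m : c *: m = zact (c *: 1) m by rewrite actZl act_one.
by rewrite !e phi_act.
Qed.

Lemma endo0 : phi 0 = 0.
Proof. by apply: (addrI (phi 0)); rewrite -phi_add !addr0. Qed.

(** An endomorphism commutes with the idempotents at the vertices. *)
Lemma endo_vert y z : phi (delta k y) z != 0 -> node_vert z = node_vert y.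
Proof.
pose v := node_vert y; pose b := path_elt k (triv_path v).
have actb m x : zact b m x = if node_vert x == v then m x else 0.
  pose ev x : W -> k^o := fun m => m x.
  have ev_lin x' : linear (ev x') by move=> c m1 m2; rewrite /ev !ffunE.
  apply: (delta_lin_eq (f := fun m => ev x (zact b m))
    (g := fun m => if node_vert x == v then ev x m else 0)) => [c m1 m2|c m1 m2|x'].
  - by rewrite act_is_linear ev_lin.
  - by case: eqP => _; rewrite ?ev_lin // scaler0 addr0.
  rewrite /ev act_path /pwalk /psrc /=; case: (eqVneq x x') => [->|nx].
    by case: eqP => _ /=; rewrite ?deltaE ?eqxx // ffunE.
  rewrite deltaE (negPf nx) if_same.
  by case: eqP => _ /=; rewrite ?deltaE ?(negPf nx) // ffunE.
have eb : zact b (delta k y) = delta k y.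
  by rewrite act_path /pwalk /psrc /= eqxx.
by rewrite -eb phi_act actb; case: (node_vert z =P v) => // _; rewrite eqxx.
Qed.

Let coef (j j' : nat) : k := phi (delta k (top (inord j))) (top (inord j')).

(** The socle i is the image of the top i + b under the word of the piece (i, b), with
which phi commutes. The coefficient on the right vanishes if the word of the piece
(i', b) is a different one, because the tops then lie over different vertices. *)
Lemma endo_soc i (b : bool) i' :
  phi (delta k (soc i)) (soc i') = coef (i + b) (i' + b).
Proof.
have -> : delta k (soc i) = zact (word_elt k (u (i, b))) (delta k (top (piece_top (i, b)))).
  by rewrite zact_delta_word walk_piece.
rewrite phi_act; case: (eqVneq (u (i', b)) (u (i, b))) => [eu|nu].
  by rewrite act_piece_soc.
rewrite act_piece_other => [|i2 [<-] /= e]; last by rewrite e eqxx in nu.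
apply/esym/eqP; apply: contraNT nu => /endo_vert /= e.
by apply/eqP/u_top.
Qed.

Lemma endo_soc_other i z : (forall i', z <> soc i') -> phi (delta k (soc i)) z = 0.
Proof.
move=> nz.
have -> : delta k (soc i) = zact (word_elt k (u (i, false))) (delta k (top (piece_top (i, false)))).
  by rewrite zact_delta_word walk_piece.
by rewrite phi_act act_piece_other // => i' /nz.
Qed.

(** Both coefficients are the one of [endo_soc], computed with the two pieces that
end at the socle. *)
Lemma coefS i i' : (i <= n)%N -> (i' <= n)%N -> coef i.+1 i'.+1 = coef i i'.
Proof.
move=> le le'; have := endo_soc (inord i) true (inord i').
by rewrite (endo_soc _ false) !inordK // !addn1 !addn0 => ->.
Qed.

(** No word of a piece (i, false) starts at the last top. *)
Lemma coef_last i : (i <= n)%N -> coef n.+1 i = 0.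
Proof.
move=> le; pose r : piece := (inord i, false).
have e0 : zact (word_elt k (u r)) (delta k (top (inord n.+1))) = 0.
  rewrite zact_delta_word; case E: zwalk => [z|] //.
  have [r' [_ e2 [/(congr1 val) e] _]] := walk_pieceI E.
  move: e; rewrite piece_top_val e2 /= addn0 inordK // => e.
  by have := ltn_ord r'.1; rewrite -e ltnn.
have := congr1 phi e0; rewrite phi_act endo0 => /(congr1 (fun m => m (soc (inord i)))).
by rewrite (act_piece_soc (r := r)) // ffunE /piece_top /= inordK // addn0.
Qed.

(** No word of a piece (i, true) starts at the first top. *)
Lemma coef_first i : (i <= n)%N -> coef 0 i.+1 = 0.
Proof.
move=> le; pose r : piece := (inord i, true).
have e0 : zact (word_elt k (u r)) (delta k (top (inord 0))) = 0.
  rewrite zact_delta_word; case E: zwalk => [z|] //.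
  have [r' [_ e2 [/(congr1 val) e] _]] := walk_pieceI E.
  by move: e; rewrite piece_top_val e2 /= addn1 inordK.
have := congr1 phi e0; rewrite phi_act endo0 => /(congr1 (fun m => m (soc (inord i)))).
by rewrite (act_piece_soc (r := r)) // ffunE /piece_top /= inordK // addn1.
Qed.

Lemma coef_diag j : (j <= n.+1)%N -> coef j j = coef 0 0.
Proof. by elim: j => // j IH lt; rewrite coefS // IH // ltnW. Qed.

(** The coefficients are constant along diagonals, and each diagonal other than the
main one meets the last row or the first row in a zero. *)
Lemma coef_off j j' : (j <= n.+1)%N -> (j' <= n.+1)%N -> j != j' -> coef j j' = 0.
Proof.
move=> lj lj'; rewrite neq_ltn => /orP[lt|lt].
  elim: j j' lt lj lj' => [|j IH] [|j'] // lt lj lj'; first exact: coef_first.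
  by rewrite coefS // IH // ltnW.
move: (subnKC lj) lj'; move: (n.+1 - j)%N => d.
elim: d j j' lt {lj} => [|d IH] j j' lt e lj'.
  by rewrite -[j]addn0 e coef_last // -ltnS -e addn0.
rewrite -coefS //.
- by apply: IH; rewrite ?addSnnS // (leq_trans lt) // -e leq_addr.
- by rewrite -ltnS -e addnS ltnS leq_addr.
- by rewrite -ltnS (leq_trans lt) // -e leq_addr.
Qed.

Lemma endo_top j j' : phi (delta k (top j)) (top j') = (j == j')%:R * coef 0 0.
Proof.
rewrite -[j in LHS]inord_val -[j' in LHS]inord_val -/(coef j j').
case: eqP => [->|/eqP ne]; first by rewrite mul1r coef_diag // -ltnS.
by rewrite mul0r coef_off // -ltnS.
Qed.

Lemma endo_top_mid j r (o : 'I_(size (u r)).-1) : phi (delta k (top j)) (mid o) = 0.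
Proof.
apply/eqP; apply: contraT => /endo_vert /= e; exfalso.
by apply: (@u_mid r o j) e; rewrite -ltn_predRL ltn_ord.
Qed.

Lemma endo_soc_scalar i i' :
  phi (delta k (soc i)) (soc i') = (i == i')%:R * coef 0 0.
Proof.
have le (x : 'I_n.+1) : (x <= n.+1)%N by exact: ltnW (ltn_ord x).
rewrite (endo_soc i false) !addn0; case: eqP => [->|/eqP ne].
  by rewrite mul1r coef_diag.
by rewrite mul0r coef_off.
Qed.

Lemma node_gen y : exists j w, zwalk w (top j) = Some y.
Proof.
case: y => [[j|i]|[r o]].
- by exists j, [::].
- by exists (piece_top (i, false)), (u (i, false)); rewrite walk_piece.
have lt : (o.+1 < size (u r))%N by rewrite -ltn_predRL; exact: ltn_ord.
exists (piece_top r), (drop o.+1 (u r)); rewrite walk_drop ?(ltnW lt) //.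
have [o' -> eo] := node_mid lt; congr Some; congr inr; congr Tagged.
exact: val_inj.
Qed.

Hypothesis phi_idem : forall m, phi (phi m) = phi m.

Lemma endo_sum y : phi (phi (delta k y)) = \sum_z phi (delta k y) z *: phi (delta k z).
Proof.
pose F : {linear _ -> _} := HB.pack phi (GRing.isLinear.Build _ _ _ _ _ endo_linear).
rewrite {1}[phi (delta k y)]sum_delta -[phi (\sum_z _)]/(F _) linear_sum.
by apply: eq_bigr => z _; rewrite linearZ.
Qed.

(** This coefficient is multiplicative, as no socle is mapped to a combination
involving tops. *)
Lemma coef_idem : coef 0 0 = 0 \/ coef 0 0 = 1.
Proof.
set c := coef 0 0.
suff /eqP : c * c = c.
  by rewrite -subr_eq0 -{3}[c]mulr1 -mulrBr mulf_eq0 subr_eq0 => /orP[]/eqP; [left|right].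
pose t := top (inord 0).
have := congr1 (fun m : W => m t) (endo_sum t).
rewrite /= phi_idem sum_ffunE (bigD1 t) //= big1 => [|[[j|i]|[r o]] ne].
- by rewrite addr0 ffunE -/(coef 0 0) -/c => /esym.
- rewrite ffunE endo_top; case: eqP => [ej|_]; last by rewrite mul0r scale0r.
  by case/eqP: ne; rewrite /t ej.
- by rewrite ffunE endo_soc_other ?scaler0.
- by rewrite ffunE -[inr _]/(mid o) endo_top_mid scale0r.
Qed.

(** If the diagonal coefficient is zero, phi maps tops into the span of the socles and
kills the socles, so phi = phi o phi kills the tops, and these generate. *)
Lemma endo_nil : coef 0 0 = 0 -> forall m, phi m = 0.
Proof.
move=> c0.
have socs i : phi (delta k (soc i)) = 0.
  apply/ffunP => z; rewrite [RHS]ffunE; case: z => [[j|i']|s].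
  - by apply: endo_soc_other.
  - by rewrite endo_soc_scalar c0 mulr0.
  - by apply: endo_soc_other.
have tops j : phi (delta k (top j)) = 0.
  rewrite -phi_idem endo_sum big1 // => -[[j'|i]|[r o]] _.
  - by rewrite endo_top c0 mulr0 scale0r.
  - by rewrite socs scaler0.
  - by rewrite -[inr _]/(mid o) endo_top_mid scale0r.
apply: delta_lin_eq (endo_linear) _ _ => [c m1 m2|y]; first by rewrite scaler0 addr0.
have [j [w E]] := node_gen y.
have -> : delta k y = zact (word_elt k w) (delta k (top j)) by rewrite zact_delta_word E.
by rewrite phi_act tops linear0.
Qed.

End Endomorphism.

Lemma zigzag_idempotent (phi : W -> W) :
  {morph phi : m1 m2 / m1 + m2} ->
  (forall b m, phi (zact b m) = zact b (phi m)) ->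
  (forall m, phi (phi m) = phi m) ->
  (forall m, phi m = 0) \/ (forall m, phi m = m).
Proof.
move=> phiD phiA phiI; have [c0|c1] := coef_idem phiD phiA phiI.
  by left; exact: endo_nil c0.
right=> m; apply/eqP; rewrite eq_sym -subr_eq0; apply/eqP; move: m.
pose psi m := m - phi m.
have phiN m : phi (- m) = - phi m.
  by apply/eqP; rewrite -subr_eq0 opprK -phiD addNr endo0.
have := @endo_nil psi; apply.
- by move=> m1 m2; rewrite /psi phiD opprD addrACA.
- by move=> b m; rewrite /psi phiA linearB.
- by move=> m; rewrite /psi phiD phiN phiI subrr subr0.
by rewrite /psi !ffunE c1 eqxx subrr.
Qed.

Lemma zigzag_generated m : exists c : 'I_n.+2 -> pathAlg k Q,
  m = \sum_j zact (c j) (delta k (top j)).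
Proof.
pose P m := exists c : 'I_n.+2 -> pathAlg k Q, m = \sum_j zact (c j) (delta k (top j)).
have PD m1 m2 : P m1 -> P m2 -> P (m1 + m2).
  move=> [c1 ->] [c2 ->]; exists (fun j => c1 j + c2 j).
  by rewrite -big_split; apply: eq_bigr => j _; rewrite actDl.
have PZ a m1 : P m1 -> P (a *: m1).
  move=> [c ->]; exists (fun j => a *: c j).
  by rewrite scaler_sumr; apply: eq_bigr => j _; rewrite actZl.
have P0 : P 0 by exists (fun=> 0); rewrite big1 // => j _; rewrite act0l.
rewrite -/(P m) [m]sum_delta; elim/big_rec: _ => // y m1 _; apply: PD; apply: PZ.
have [j [w E]] := node_gen y; exists (fun j' => if j' == j then word_elt k w else 0).
rewrite (bigD1 j) //= eqxx big1 ?addr0 => [|j' /negPf->]; last exact: act0l.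
by rewrite zact_delta_word E.
Qed.

Lemma card_node : (n < #|node_type|)%N.
Proof. by rewrite !card_sum !card_ord addSn addSn ltnS -addnA leqW // leq_addr. Qed.

(** A decomposition of the module gives an idempotent endomorphism, the projection
onto the first summand. *)
Lemma zigzag_module (A : algType k) (S : pathAlg k Q -> Prop)
    (f : {linear A -> quotAlg S}) :
  monoid_morphism f -> bijective f ->
  (forall b y, S b -> zact b (delta k y) = 0) ->
  exists M : lmodType A, [/\ finitely_generated M, indecomposable M &
    exists2 Y : finType, (n < #|Y|)%N & has_basis M Y].
Proof.
move=> fM fB rel0.
have [||||| M [j [jB jD jA jA' jZ]]] :=
    @quotient_module k A (pathAlg k Q) S f W zact fM fB.
- by move=> b m1 m2; rewrite linearD.
- by move=> b c m; rewrite actDl.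
- by move=> b c m; rewrite (act_mul zstep_vert).
- by move=> a m; rewrite actZl act_one.
- move=> b m Sb; apply: (delta_lin_eq (f := zact b) (g := fun=> 0)) => [|c m1 m2|y].
  + exact: act_is_linear.
  + by rewrite scaler0 addr0.
  + exact: rel0.
have j0 : j 0 = 0 by apply: (addrI (j 0)); rewrite -jD !addr0.
have [j' jK j'K] := jB.
exists M; split; last by exists node_type; [exact: card_node | exists j].
  exists n.+2, (fun i => j (delta k (top i))) => m.
  have [c ec] := zigzag_generated (j' m).
  have /choice[a ea] i : exists a : A, forall m, a *: j m = j (zact (c i) m) by exact: jA.
  exists a; rewrite -[m in LHS]j'K ec (big_morph j jD j0).
  by apply: eq_bigr => i _; rewrite ea.
split=> [M0|M1 M2 [g [g' gK g'K]]].
  have := M0 (j (delta k (top ord0))); rewrite -j0 => /(can_inj jK)/ffunP.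
  move=> /(_ (top ord0)); rewrite deltaE eqxx ffunE => /eqP.
  by rewrite oner_eq0.
have g'D x y : g' (x + y) = g' x + g' y.
  by apply: (can_inj gK); rewrite linearD !g'K.
have g'Z a x : g' (a *: x) = a *: g' x.
  by apply: (can_inj gK); rewrite linearZ !g'K.
have g'0 : g' 0 = 0 by apply: (can_inj gK); rewrite linear0 g'K.
have j'D x y : j' (x + y) = j' x + j' y by apply: (can_inj jK); rewrite jD !j'K.
pose pr (x : M1 * M2) : M1 * M2 := (x.1, 0).
pose phi m := j' (g' (pr (g (j m)))).
have [||| phi0 | phi1] := @zigzag_idempotent phi.
- move=> m1 m2; rewrite /phi jD linearD -j'D -g'D; congr (j' (g' _)).
  by rewrite /pr /= -[RHS]/(_, 0 + 0) addr0.
- move=> b m; have [a ea] := jA b; apply: (can_inj jK).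
  rewrite -ea /phi !j'K -ea linearZ -g'Z; congr (g' _).
  by rewrite /pr -[RHS]/(_, a *: 0) scaler0.
- by move=> m; rewrite /phi j'K g'K.
- left=> x; have := phi0 (j' (g' (x, 0))); rewrite /phi j'K g'K /pr /=.
  by move=> /(congr1 j); rewrite j'K j0 -g'0 => /(can_inj g'K)[].
- right=> y; have := phi1 (j' (g' (0, y))); rewrite /phi j'K g'K /pr /=.
  by move=> /(congr1 j); rewrite !j'K => /(can_inj g'K)[].
Qed.

End Zigzag.

(** * Words in the quiver of an sf Brauer graph *)

Section Words.
Variable T : eqType.
Implicit Types (u v : seq T) (p : pred T).

Lemma infix_count p u v : infix u v -> (count p u <= count p v)%N.
Proof. by case/infixP=> s [s' ->]; rewrite !count_cat addnCA leq_addr. Qed.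

Lemma common_prefixP x u v i : (i < common_prefix u v)%N ->
  [/\ (i < size u)%N, (i < size v)%N & nth x u i = nth x v i].
Proof.
move=> lt; have lz : (i < size (zip u v))%N by apply: leq_trans lt (find_size _ _).
have := before_find (x, x) lt; rewrite nth_zip_cond lz /= => /negbFE/eqP e.
by move: lz; rewrite size_zip leq_min => /andP[].
Qed.

Lemma trim_sub u v : {subset trim u v <= u}.
Proof. by move=> x /mem_drop/mem_take. Qed.

Lemma trim_count p u v :
  (forall x i, (i < common_prefix u v)%N -> ~~ p (nth x u i)) ->
  (forall x i, (i < common_prefix (rev u) (rev v))%N -> ~~ p (nth x (rev u) i)) ->
  count p (trim u v) = count p u.
Proof.
have none c w : (forall x i, (i < c)%N -> ~~ p (nth x w i)) -> count p (take c w) = 0%N.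
  move=> np; apply/eqP; rewrite -leqn0 leqNgt -has_count; apply/hasP => -[x xw px].
  have := xw; rewrite -index_mem => lt; have := lt; rewrite size_take_min leq_min.
  case/andP=> lc _; have := np x _ lc.
  by rewrite -(nth_take _ lc) nth_index ?px.
move=> pre suf; rewrite /trim /=.
set c := common_prefix u v; set c' := common_prefix (rev u) (rev v).
have splitc m w : count p w = (count p (take m w) + count p (drop m w))%N.
  by rewrite -count_cat cat_take_drop.
rewrite [RHS](splitc (size u - c')%N) -[count p (drop _ u)]count_rev.
rewrite -take_rev (none _ _ suf) addn0 [RHS](splitc c).
rewrite [count p (take c _)](_ : _ = 0%N) //; apply/eqP.
rewrite -take_min minnC take_min -leqn0 -(none _ _ pre).
by rewrite [leqRHS](splitc (size u - c')%N) leq_addr.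
Qed.

Lemma traject_mul (f : T -> T) x o n : iter o f x = x ->
  flatten (nseq n (traject f x o)) = traject f x (n * o).
Proof. by move=> e; elim: n => //= n ->; rewrite mulSn trajectD e. Qed.

End Words.

Section SfBrauerGraph.
Variable B : sfBrauerGraph.
Implicit Types a b : arrow B.

Definition letter_unlabeled (x : larrow B) : bool := larr_src x \notin labels B.
Local Notation unl := (fun a : arrow B => ~~ arr_labeled a).

Lemma letter_unlabeled_pi a : letter_unlabeled (arr_pi a) = ~~ arr_labeled a.
Proof. by rewrite /letter_unlabeled larr_src_pi. Qed.

Lemma arr_pi_inj a b : ~~ arr_labeled a -> arr_pi a = arr_pi b -> a = b.
Proof.
by move=> ua /arr_piP /orP[/eqP //|/andP[_ la]]; rewrite la in ua.
Qed.

Lemma count_pi_word w : count letter_unlabeled (pi_word w) = count unl w.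
Proof. by rewrite count_map; apply: eq_count => a /=; rewrite letter_unlabeled_pi. Qed.

(** The number of unlabeled half-edges at the vertex of the arrow. *)
Definition turn_count a : nat := count unl (special_cycle a).

Lemma special_powerE a :
  special_power a = traject (@sigma B) a (arr_mult a * fingraph.order (@sigma B) a).
Proof. by apply: traject_mul; apply: iter_order; apply: sigma_inj. Qed.

Lemma special_power_size a :
  size (special_power a) = (arr_mult a * fingraph.order (@sigma B) a)%N.
Proof. by rewrite special_powerE size_traject. Qed.

Lemma special_power_count a : count unl (special_power a) = (arr_mult a * turn_count a)%N.
Proof.
rewrite /special_power /turn_count; elim: (arr_mult a) => //= n IH.
by rewrite count_cat IH mulSn.
Qed.

Lemma val_iter_sigma e a :
  val (iter e (@sigma B) a) = iter e (hrot B)^-1%g (val a).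
Proof. by elim: e => //= e ->. Qed.

Lemma hsrc_iter_rotV e (h : halfedge B) : hsrc (iter e (hrot B)^-1%g h) = hsrc h.
Proof. by elim: e => //= e; rewrite hsrc_rotV. Qed.

Lemma special_power_iter a : iter (size (special_power a)) (@sigma B) a = a.
Proof.
rewrite special_powerE size_traject; elim: (arr_mult a) => //= n IH.
by rewrite mulSn iterD IH iter_order //; apply: sigma_inj.
Qed.

(** Where the two words agree in an unlabeled letter, the letters come from the same
arrow; turning on from this arrow, for prefixes, or back, for suffixes, would give
[a = b]. So the common prefix and the common suffix are labeled. *)
Lemma trim_special_count a b : a != b ->
  let w := pi_word (special_power a) in
  count letter_unlabeled (trim w (pi_word (special_power b))) =
  count letter_unlabeled w.
Proof.
move=> ab /=; have iter_inj i : injective (iter i (@sigma B)).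
  by elim: i => //= i IH x y /sigma_inj/IH.
apply: trim_count => x i /(common_prefixP x).
  rewrite !size_map => -[lt lt']; rewrite !(nth_map a) //.
  move: lt lt'; rewrite !special_powerE !size_traject => lt lt'.
  rewrite nth_traject // (set_nth_default b) ?size_traject // nth_traject //.
  move=> e; rewrite letter_unlabeled_pi; apply: contraNN ab => ua.
  by apply/eqP/(iter_inj i)/arr_pi_inj.
rewrite !size_rev !size_map => -[lt lt'].
have sp c j : (j < size (special_power c))%N ->
    iter j.+1 (@sigma B) (nth a (special_power c) (size (special_power c) - j.+1)) = c.
  move=> lj.
  have ls : (size (special_power c) - j.+1 < size (special_power c))%N.
    by rewrite ltn_subrL /= (leq_ltn_trans _ lj).
  rewrite (set_nth_default c) // {1}special_powerE nth_traject; last first.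
    by rewrite -special_power_size.
  by rewrite -iterD subnKC // special_power_iter.
rewrite !nth_rev ?size_map // !(nth_map a) ?ltn_subrL ?(leq_ltn_trans _ lt) //;
  last by rewrite (leq_ltn_trans _ lt').
move=> e; rewrite letter_unlabeled_pi; apply: contraNN ab => ua.
by rewrite -(sp a i lt) -(sp b i lt') (arr_pi_inj ua e).
Qed.

Lemma special_cycle_vertex a b : hsrc (val a) = hsrc (val b) -> b \in special_cycle a.
Proof.
move=> e; rewrite -[special_cycle a]/(fingraph.orbit _ _) -fconnect_orbit.
have : val b \in porbit (hrot B)^-1%g (val a) by rewrite porbitV hsrc_porbit e.
case/porbitP=> i; rewrite permX -val_iter_sigma => /val_inj->.
exact: fconnect_iter.
Qed.

Lemma special_power_vertex a b : b \in special_power a -> hsrc (val b) = hsrc (val a).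
Proof.
rewrite special_powerE => /trajectP[i _ ->].
by rewrite val_iter_sigma hsrc_iter_rotV.
Qed.

(** * Segments of a curve *)

Hypothesis labels_neqT : labels B != [set: edge B].
(** In the applications C consists of the half-edges of a cycle, or of a path between
two vertices of multiplicity at least 2, in the graph of unlabeled edges. *)
Variable C : {set halfedge B}.
Hypothesis C_inv : forall h, h \in C -> hinv h \in C.
Hypothesis C_unlabeled : forall h, h \in C -> edge_of h \notin labels B.
Hypothesis C_two : forall g h h', g \in C -> h \in C -> h' \in C ->
  hsrc g = hsrc h -> hsrc g = hsrc h' -> [\/ g = h, g = h' | h = h'].
Hypothesis C_one : forall g, g \in C ->
  (exists2 h, h \in C & h != g /\ hsrc h = hsrc g) \/ (2 <= mult (hsrc g))%N.
Local Notation rotV := (hrot B)^-1%g.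
Implicit Types c d h : halfedge B.

(** The number of turns back from [c] until C is met again; for [c] in C this happens
within the order of the rotation. *)
Definition seg_len c : nat :=
  (find (fun e => iter e.+1 rotV c \in C) (iota 0 #[rotV]%g)).+1.

(** The other element of C at the vertex of [c], or [c] if there is none. *)
Definition partner c : halfedge B := iter (seg_len c) rotV c.

Lemma partner_mem c : c \in C -> partner c \in C.
Proof.
move=> cC; pose p e := iter e.+1 rotV c \in C.
have hp : has p (iota 0 #[rotV]%g).
  apply/hasP; exists #[rotV]%g.-1; first by rewrite mem_iota add0n ltn_predL order_gt0.
  by rewrite /p prednK ?order_gt0 // -permX expg_order perm1.
have := nth_find 0%N hp; rewrite nth_iota // -[X in (_ < X)%N](size_iota 0) -?has_find //.
Qed.

Lemma seg_len_min c e : (0 < e < seg_len c)%N -> iter e rotV c \notin C.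
Proof.
case: e => // e /=; rewrite /seg_len ltnS => lt; have := before_find 0%N lt.
rewrite nth_iota ?add0n => [/negbT //|].
by apply: leq_trans lt _; rewrite -[leqRHS](size_iota 0) find_size.
Qed.

Lemma hsrc_partner c : hsrc (partner c) = hsrc c.
Proof. exact: hsrc_iter_rotV. Qed.

(** If a full turn from [d] does not meet C in between, then [d] is the only element
of C at its vertex. *)
Lemma partner_fix c d : c \in C -> hsrc d = hsrc c -> partner d = d -> c = d.
Proof.
move=> cC e fd; have : c \in porbit rotV d by rewrite porbitV hsrc_porbit e.
case/porbitP=> i; rewrite permX (divn_eq i (seg_len d)) addnC iterD.
have -> : iter (i %/ seg_len d * seg_len d) rotV d = d.
  elim: (i %/ seg_len d)%N => // q IH.
  by rewrite mulSn iterD IH -/(partner d).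
have := @seg_len_min d (i %% seg_len d); rewrite ltn_pmod // andbT.
case: posnP => [-> //|_ /(_ isT) nC ec].
by rewrite -ec cC in nC.
Qed.

Lemma partnerK c : c \in C -> partner (partner c) = c.
Proof.
move=> cC; have pC := partner_mem cC; have ppC := partner_mem pC.
have e1 := hsrc_partner c; have e2 := hsrc_partner (partner c).
have [e|<- //|e] := C_two cC pC ppC (esym e1) (esym (etrans e2 e1)).
  by rewrite -!e.
by rewrite -e; apply/esym/partner_fix.
Qed.

(** A truncated vertex has a single half-edge and multiplicity 1. *)
Lemma hsrc_nontruncated c h : c \in C -> hsrc h = hsrc c -> ~~ truncated (hsrc h).
Proof.
move=> cC ->; rewrite /truncated; apply/negP => /andP[/eqP m1 /eqP v1].
case: (C_one cC) => [[h' _ [ne e]]|]; last by rewrite m1.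
have /cards1P[x ex] : valency (hsrc c) == 1%N by rewrite v1.
have : c \in halves_at (hsrc c) by rewrite inE.
have : h' \in halves_at (hsrc c) by rewrite inE e.
by rewrite ex !inE => /eqP hx /eqP cx; rewrite hx cx eqxx in ne.
Qed.

Variable h0 : halfedge B.
Hypothesis h0C : h0 \in C.

Definition base_arrow : arrow B := Sub h0 (hsrc_nontruncated h0C erefl).
(** Used only for half-edges at vertices that meet C, which are not truncated; the
default value is there to make the function total. *)
Definition arrow_of h : arrow B := insubd base_arrow h.

Lemma val_arrow_of c h : c \in C -> hsrc h = hsrc c -> val (arrow_of h) = h.
Proof. by move=> cC e; rewrite val_insubd (hsrc_nontruncated cC e). Qed.

(** The path from the edge of [partner c] to the edge of [c] around their vertex. *)
Definition segment c : seq (arrow B) :=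
  traject (@sigma B) (arrow_of (rotV c)) (seg_len c).

Definition segment_letter c e : arrow B := iter e (@sigma B) (arrow_of (rotV c)).

Lemma val_segment_letter c e : c \in C ->
  val (segment_letter c e) = iter e.+1 rotV c.
Proof.
move=> cC; rewrite val_iter_sigma (val_arrow_of cC) ?hsrc_rotV //.
by rewrite -iterSr.
Qed.

Lemma segment_letter_mem c e : c \in C -> (e < seg_len c)%N ->
  val (segment_letter c e) \in C -> e.+1 = seg_len c.
Proof.
move=> cC lt; rewrite val_segment_letter // => iC; apply/eqP.
rewrite eqn_leq lt /= leqNgt; apply/negP => lt'.
by have := @seg_len_min c e.+1; rewrite lt' iC => /(_ isT).
Qed.

Lemma segment_mem c a : c \in C -> a \in segment c -> val a \in C ->
  val a = partner c.
Proof.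
move=> cC /trajectP[e lt ->] aC; rewrite -/(segment_letter c e) in aC *.
by have := segment_letter_mem cC lt aC; rewrite val_segment_letter // => ->.
Qed.

Lemma segment_uniq c : c \in C -> uniq (segment c).
Proof.
move=> cC; apply/(uniqPn base_arrow) => -[i [j [lt]]]; rewrite size_traject => lj.
rewrite !(set_nth_default (arrow_of (rotV c)) base_arrow) ?size_traject ?(ltn_trans lt) //.
rewrite !nth_traject ?(ltn_trans lt) // => /(congr1 val).
rewrite -!/(segment_letter c _) !val_segment_letter //.
have rI : injective (iter i.+1 rotV) by elim: i.+1 => //= m IH x y /perm_inj/IH.
have {1}-> : j.+1 = (i.+1 + (j - i))%N by rewrite addSn subnKC // ltnW.
rewrite iterD => /rI ec.
have := @seg_len_min c (j - i); rewrite -ec cC subn_gt0 lt /=.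
by rewrite (leq_ltn_trans (leq_subr _ _) lj) => /(_ isT).
Qed.

Lemma segment_src c a : c \in C -> a \in segment c -> hsrc (val a) = hsrc c.
Proof.
move=> cC /trajectP[e _ ->].
by rewrite -/(segment_letter c e) val_segment_letter // hsrc_iter_rotV.
Qed.

Lemma arr_labeledE a : arr_labeled a = (edge_of (val a) \in labels B).
Proof. by []. Qed.

Lemma turn_count_gt0 a : (0 < turn_count a)%N.
Proof.
have [h hv hu] := unlabeled_at labels_neqT (hsrc (val a)).
have nh : ~~ truncated (hsrc h) by rewrite hv (valP a).
pose b : arrow B := Sub h nh.
rewrite /turn_count -has_count; apply/hasP; exists b; last by rewrite arr_labeledE.
by apply: special_cycle_vertex; rewrite -hv.
Qed.

(** The letters of a segment are distinct, so there are at most as many unlabeled ones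
as there are unlabeled half-edges at the vertex. This is enough if the multiplicity
is at least 2. Otherwise C has a second element at the vertex, and the segment
stops before it reaches the arrow of [c] itself. *)
Lemma segment_count c a : c \in C -> hsrc (val a) = hsrc c ->
  (count unl (segment c) < arr_mult a * turn_count a)%N.
Proof.
move=> cC ea; rewrite -size_filter /arr_mult ea.
have sub b : b \in segment c -> b \in special_cycle a.
  by move=> bs; apply: special_cycle_vertex; rewrite ea (segment_src cC bs).
have sz : (size (filter unl (segment c)) <= turn_count a)%N.
  rewrite /turn_count -size_filter; apply: uniq_leq_size.
    by rewrite filter_uniq // segment_uniq.
  by move=> b; rewrite !mem_filter => /andP[-> /sub].
case: (ltnP 1 (mult (hsrc c))) => [m2|m1].
  apply: leq_ltn_trans sz _.
  by rewrite -[ltnLHS]mul1n ltn_pmul2r // turn_count_gt0.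
have [[h hC [ne eh]]|] := C_one cC; last by rewrite leqNgt ltnS m1.
apply: leq_trans (_ : (turn_count a <= _)%N); last by rewrite leq_pmull // mult_gt0.
have vc : val (arrow_of c) = c by apply: (val_arrow_of cC).
rewrite /turn_count -[count _ (special_cycle a)]size_filter.
apply: (@uniq_leq_size _ (arrow_of c :: filter unl (segment c))).
  rewrite cons_uniq filter_uniq ?segment_uniq // andbT mem_filter negb_and.
  apply/orP; right; apply/negP => cs.
  have := segment_mem cC cs; rewrite vc => /(_ cC) pc.
  by case/eqP: ne; apply: partner_fix.
move=> b; rewrite inE => /orP[/eqP->|].
  rewrite mem_filter arr_labeledE vc C_unlabeled //=.
  by apply: special_cycle_vertex; rewrite vc.
by rewrite !mem_filter => /andP[-> /sub].
Qed.

(** Counting unlabeled letters, [w] does not fit in a segment at the vertex of [a]; at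
other vertices it shares no unlabeled letter with the segment. *)
Lemma long_word_not_infix c a (w : seq (larrow B)) : c \in C ->
  {subset w <= pi_word (special_power a)} ->
  (arr_mult a * turn_count a <= count letter_unlabeled w)%N ->
  ~~ infix w (pi_word (segment c)).
Proof.
move=> cC sub le; apply/negP => inf.
have w0 : (0 < count letter_unlabeled w)%N.
  by apply: leq_trans le; rewrite muln_gt0 mult_gt0 turn_count_gt0.
have ea : hsrc (val a) = hsrc c.
  move: w0; rewrite -has_count => /hasP[x xw xu].
  have /mapP[b bs eb] := sub x xw; have /mapP[b' bs' eb'] := mem_infix inf xw.
  rewrite eb letter_unlabeled_pi in xu.
  rewrite -(segment_src cC bs') -(special_power_vertex bs).
  by congr (hsrc (val _)); apply: arr_pi_inj => //; rewrite -eb.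
have := infix_count letter_unlabeled inf; rewrite count_pi_word leqNgt.
by rewrite (leq_trans (segment_count cC ea)).
Qed.

(** The outer letters are unlabeled, hence determined as arrows by their classes, and
arrows of a segment at distance d differ by d turns. *)
Lemma zero_path_not_infix c (an a1 : arrow B) (mid : seq (arrow B)) : c \in C ->
  ~~ arr_labeled a1 -> ~~ arr_labeled an ->
  infix (pi_word (an :: rcons mid a1)) (pi_word (segment c)) ->
  iter (size mid).+1 (@sigma B) an = a1.
Proof.
move=> cC u1 un /infixP[s [s' e]].
have letter i x : (i < size (an :: rcons mid a1))%N ->
    (size s + i < seg_len c)%N /\
    arr_pi (nth x (an :: rcons mid a1) i) = arr_pi (segment_letter c (size s + i)).
  move=> lt; have := congr1 size e; rewrite size_map size_traject !size_cat size_map => es.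
  have lt' : (size s + i < seg_len c)%N.
    by rewrite es ltn_add2l (leq_trans lt) // leq_addr.
  split=> //; have : nth (arr_pi x) (pi_word (segment c)) (size s + i) =
    nth (arr_pi x) (pi_word (an :: rcons mid a1)) i.
    by rewrite e -nth_drop drop_size_cat // nth_cat size_map lt.
  rewrite [in RHS](nth_map x) //.
  rewrite (nth_map x) ?size_traject // => <-; congr arr_pi.
  by rewrite (set_nth_default (arrow_of (rotV c))) ?size_traject // nth_traject.
have [_ en] := letter 0%N a1 isT.
have [|_ e1] := letter (size mid).+1 a1; first by rewrite /= size_rcons.
rewrite addn0 in en; rewrite /= nth_rcons ltnn eqxx in e1.
rewrite (arr_pi_inj un en) (arr_pi_inj u1 e1) /segment_letter -iterD.
by rewrite addnC.
Qed.

(** * The zigzag along a curve *)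

(** The walk crosses an edge of C and then passes to the other half-edge of C at the
vertex it has reached. At the end of a path it turns round, after a full turn. *)
Definition stroll i : halfedge B := iter i (fun h => partner (hinv h)) h0.

Lemma stroll_mem i : stroll i \in C.
Proof. by elim: i => //= i IH; rewrite partner_mem ?C_inv. Qed.

(** Turning back at the vertex reached undoes the last step. *)
Lemma partner_strollS i : partner (stroll i.+1) = hinv (stroll i).
Proof. by rewrite /= partnerK // C_inv ?stroll_mem. Qed.

(** If the walk passed the same edge in both directions at two times of equal parity,
then so it would one step later and one step earlier, respectively, and finally at
one and the same time; but a half-edge is not its own opposite. Hence an edge that
occurs as a top again is left by the same words as before. *)
Lemma stroll_no_reversal i (t : nat) : stroll i != hinv (stroll (i + t.*2)).
Proof.
elim: t i => [|t IH] i; first by rewrite addn0 eq_sym hinv_neq.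
apply/eqP => e; case/eqP: (IH i.+1); apply: (can_inj (@hinvK B)).
rewrite hinvK /= e hinvK doubleS addnS partner_strollS hinvK.
by rewrite addnS.
Qed.

Lemma stroll_even_odd_reversal i j : odd i = odd j -> stroll i != hinv (stroll j).
Proof.
move=> ij; wlog le : i j ij / (i <= j)%N.
  move=> th; case/orP: (leq_total i j) => le; first exact: th.
  by rewrite eq_sym (can2_eq (@hinvK B) (@hinvK B)) th.
have -> : j = (i + (j - i)./2.*2)%N.
  by rewrite even_halfK ?subnKC // oddB // ij addbb.
exact: stroll_no_reversal.
Qed.

Lemma stroll_edge i j : odd i = odd j ->
  edge_of (stroll i) = edge_of (stroll j) -> stroll i = stroll j.
Proof.
move=> ij /eqP; rewrite edge_ofE => /orP[/eqP//|].
by rewrite (negPf (stroll_even_odd_reversal ij)).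
Qed.

Section Module.
Variable n : nat.
Local Notation piece := ('I_n.+1 * bool)%type.
Implicit Types r : piece.

(** Both pieces ending at a socle are segments, into its two half-edges. *)
Definition piece_end r : halfedge B :=
  let h := stroll r.1.*2.+1 in if r.2 then hinv h else h.

Definition piece_word r : seq (qarrow (QgraphL B)) := pi_word (segment (piece_end r)).

Definition top_edge (j : 'I_n.+2) : edge B := edge_of (stroll j.*2).
Definition soc_edge (i : 'I_n.+1) : edge B := edge_of (stroll i.*2.+1).

Let a0 : qarrow (QgraphL B) := arr_pi base_arrow.

Lemma piece_end_mem r : piece_end r \in C.
Proof. by rewrite /piece_end; case: r.2; rewrite ?C_inv ?stroll_mem. Qed.

Lemma size_piece_word r : size (piece_word r) = seg_len (piece_end r).
Proof. by rewrite size_map size_traject. Qed.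

Lemma nth_piece_word r e : (e < size (piece_word r))%N ->
  nth a0 (piece_word r) e = arr_pi (segment_letter (piece_end r) e).
Proof.
rewrite size_piece_word => lt; rewrite (nth_map base_arrow) ?size_traject //.
by rewrite (set_nth_default (arrow_of (rotV (piece_end r)))) ?size_traject ?nth_traject.
Qed.

Lemma src_letter r e : (e < size (piece_word r))%N ->
  larr_src (nth a0 (piece_word r) e) = edge_of (iter e.+1 rotV (piece_end r)).
Proof.
move=> lt; rewrite nth_piece_word // larr_src_pi /arr_src.
by rewrite val_segment_letter // piece_end_mem.
Qed.

Lemma tgt_letter r e : (e < size (piece_word r))%N ->
  larr_tgt (nth a0 (piece_word r) e) = edge_of (iter e rotV (piece_end r)).
Proof.
move=> lt; rewrite nth_piece_word // larr_tgt_pi /arr_tgt.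
by rewrite val_segment_letter ?piece_end_mem //= permKV.
Qed.

Lemma size_piece_word_gt0 r : (0 < size (piece_word r))%N.
Proof. by rewrite size_piece_word. Qed.

Lemma last_letter r :
  nth a0 (piece_word r) (size (piece_word r)).-1 =
  arr_pi (segment_letter (piece_end r) (seg_len (piece_end r)).-1).
Proof.
by rewrite nth_piece_word ?ltn_predL ?size_piece_word_gt0 // size_piece_word.
Qed.

Lemma piece_path r e : (e.+1 < size (piece_word r))%N ->
  larr_src (nth a0 (piece_word r) e) = larr_tgt (nth a0 (piece_word r) e.+1).
Proof. by move=> lt; rewrite src_letter ?tgt_letter // ltnW. Qed.

Lemma piece_tgt r : larr_tgt (nth a0 (piece_word r) 0) = soc_edge r.1.
Proof.
rewrite tgt_letter ?size_piece_word_gt0 //= /piece_end.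
by case: r.2; rewrite ?edge_of_inv.
Qed.

Lemma piece_src r :
  larr_src (nth a0 (piece_word r) (size (piece_word r)).-1) = top_edge (piece_top r).
Proof.
rewrite src_letter ?ltn_predL ?size_piece_word_gt0 // prednK ?size_piece_word_gt0 //.
rewrite size_piece_word -/(partner _) /top_edge -[nat_of_ord _]/(val _) piece_top_val /piece_end.
case: r => i [] /=; first by rewrite addn1.
by rewrite addn0 -/(stroll i.*2.+1) partner_strollS edge_of_inv.
Qed.

Lemma piece_end_inj r r' : piece_end r = piece_end r' -> r.2 = r'.2.
Proof.
have ne i j : stroll i.*2.+1 != hinv (stroll j.*2.+1).
  by apply: stroll_even_odd_reversal; rewrite /= !odd_double.
rewrite /piece_end; case: r.2; case: r'.2 => // /eqP e.
  by rewrite eq_sym (negPf (ne _ _)) in e.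
by rewrite (negPf (ne _ _)) in e.
Qed.

(** The first arrow of a segment belongs to an element of C, and the other arrows of
segments do not; it determines the segment as [partner] is an involution. *)
Lemma piece_first r r' e : (e < size (piece_word r'))%N ->
  nth a0 (piece_word r') e = nth a0 (piece_word r) (size (piece_word r)).-1 ->
  [/\ piece_word r' = piece_word r, r'.2 = r.2 & e = (size (piece_word r')).-1].
Proof.
move=> lt; rewrite nth_piece_word // last_letter; rewrite size_piece_word in lt *.
have rC := piece_end_mem r; have rC' := piece_end_mem r'.
set z := segment_letter (piece_end r) _.
have vz : val z = partner (piece_end r) by rewrite val_segment_letter.
have zu : ~~ arr_labeled z by rewrite arr_labeledE vz C_unlabeled ?partner_mem.
move=> /esym/(arr_pi_inj zu) ez.
have el : e.+1 = seg_len (piece_end r').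
  by apply: segment_letter_mem => //; rewrite -ez vz partner_mem.
have ee : piece_end r' = piece_end r.
  rewrite -[LHS]partnerK // -[RHS]partnerK //; congr partner.
  by rewrite -vz ez val_segment_letter // el.
split; [by rewrite /piece_word ee | exact: piece_end_inj | by rewrite -el].
Qed.

Lemma piece_same_top r r' : r.2 = r'.2 ->
  top_edge (piece_top r) = top_edge (piece_top r') -> piece_word r = piece_word r'.
Proof.
move=> e2 /stroll_edge; rewrite -![nat_of_ord _]/(val _) !piece_top_val.
rewrite !odd_double => /(_ erefl) e; rewrite /piece_word; congr (pi_word (segment _)).
move: e; rewrite /piece_end -e2; case: r.2.
  by rewrite !addn1 !doubleS => /(congr1 partner); rewrite !partner_strollS.
by rewrite !addn0 /= => ->.
Qed.

Lemma piece_mid r e (j : 'I_n.+2) : (e.+1 < size (piece_word r))%N ->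
  larr_src (nth a0 (piece_word r) e) <> top_edge j.
Proof.
move=> lt; rewrite src_letter ?(ltnW lt) //; rewrite size_piece_word in lt.
move/eqP; rewrite edge_ofE => e'; have := @seg_len_min (piece_end r) e.+1.
by rewrite lt => /(_ isT)/negP[]; case/orP: e' => /eqP->; rewrite ?C_inv ?stroll_mem.
Qed.

Lemma word_walk_None w (y : node_type piece_word) :
  (forall c, c \in C -> ~~ infix w (pi_word (segment c))) ->
  walk (zstep a0 (u:=piece_word)) w y = None.
Proof.
move=> ni; case E: walk => [z|] //; case: (eqVneq w [::]) => [w0|wn].
  by have := ni _ h0C; rewrite w0 infix0s.
have [r] := walk_infix size_piece_word_gt0 E wn.
by rewrite (negPf (ni _ (piece_end_mem r))).
Qed.

(** All relations act by zero, even monomial by monomial, because their words do not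
fit in a segment. *)
Lemma stroll_module (k : fieldType) (A : algType k) (f : {linear A -> sfAlg B k}) :
  monoid_morphism f -> bijective f ->
  exists M : lmodType A, [/\ finitely_generated M, indecomposable M &
    exists2 Y : finType, (n < #|Y|)%N & has_basis M Y].
Proof.
move=> fM fB.
apply: (zigzag_module size_piece_word_gt0 piece_path piece_tgt piece_src
  piece_first piece_same_top piece_mid fM fB).
have kill w y : (forall c, c \in C -> ~~ infix w (pi_word (segment c))) ->
  act (node_vert a0 top_edge soc_edge) (zstep a0 (u:=piece_word)) (word_elt k w)
    (delta k y) = 0.
  move=> ni; rewrite (act_word k (zstep_vert size_piece_word_gt0 piece_path piece_tgt piece_src)).
  by rewrite word_walk_None.
have trimK a b y : a != b ->
  act (node_vert a0 top_edge soc_edge) (zstep a0 (u:=piece_word))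
    (word_elt k (trim (pi_word (special_power a)) (pi_word (special_power b))))
    (delta k y) = 0.
  move=> ab; apply: kill => c cC; apply: (long_word_not_infix (a := a)) => //.
    exact: trim_sub.
  by rewrite trim_special_count // count_pi_word special_power_count.
move=> b y; case=> {b} [e a b _ ab _ _|a|an a1 mid _ _ u1 un ne].
- by rewrite actDl actNl !trimK // 1?eq_sym // subr0.
- apply: kill => c cC; apply: (long_word_not_infix (a := a)) => //.
    move=> x /mapP[d + ->]; rewrite mem_cat => /orP[ds|]; first exact: map_f.
    rewrite inE => /eqP->; apply: map_f; rewrite special_powerE.
    have := mult_gt0 (hsrc (val a)); rewrite -/(arr_mult a); case: (arr_mult a) => // m _.
    rewrite mulSn trajectD mem_cat.
    by have := @special_cycle_vertex a a erefl; rewrite /special_cycle => ->.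
  by rewrite count_pi_word count_cat special_power_count leq_addr.
apply: kill => c cC; apply/negP => inf; case/negP: ne; apply/eqP.
exact: zero_path_not_infix inf.
Qed.

End Module.

End SfBrauerGraph.

(** * Cycles and exceptional vertices *)

Section Combinatorics.
Variables (k : fieldType) (B : sfBrauerGraph).
Hypothesis labels_neqT : labels B != [set: edge B].
Local Notation G := (delete_labeled labels_neqT).

(** While the rotation passes through labeled half-edges it commutes with the
involution, hence it also fixes the vertex at the other end. *)
Lemma adjacent_delete (v w : vertex B) :
  adjacent (G := B) v w -> adjacent (G := G) v w.
Proof.
case/existsP=> h /andP[/eqP hv /eqP hw].
have ex : exists i, edge_of (iter i (hrot B) h) \notin labels B.
  have [g gv gu] := unlabeled_at labels_neqT v.
  have : g \in porbit (hrot B) h by rewrite hsrc_porbit gv hv.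
  by case/porbitP=> i e; exists i; rewrite -permX -e.
case: (ex_minnP ex) => i ui min_i.
have src j g : hsrc (iter j (hrot B) g) = hsrc g by elim: j => //= j; rewrite hsrc_rot.
have comm j : (j <= i)%N -> hinv (iter j (hrot B) h) = iter j (hrot B) (hinv h).
  elim: j => //= j IH lt; rewrite -IH ?(ltnW lt) //.
  have : edge_of (iter j (hrot B) h) \in labels B.
    by apply: contraLR lt => /min_i; rewrite -leqNgt.
  by move/labels_labelable; apply.
apply/existsP; exists (exist _ (iter i (hrot B) h) ui : unlabeled B).
by rewrite /= /del_src /= comm // !src hv hw !eqxx.
Qed.

Lemma delete_connected : rg_connected G.
Proof.
have [n0 conn] := lrg_connected B; split=> // v w.
apply: (connect_sub (e := @adjacent B)); last exact: conn.
by move=> x y /adjacent_delete; apply: connect1.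
Qed.

(** An oriented curve: each vertex is the source of at most one of its half-edges and
the target of at most one, and it can end only at vertices of multiplicity at
least 2. *)
Section Curve.
Variable D : {set halfedge B}.
Local Notation tgt h := (hsrc (hinv h)).
Hypothesis D_unlabeled : forall h, h \in D -> edge_of h \notin labels B.
Hypothesis D_src : {in D &, injective (@hsrc B)}.
Hypothesis D_tgt : {in D &, injective (fun h => tgt h)}.
Hypothesis D_in : forall h, h \in D ->
  (exists2 g, g \in D & hinv g != h /\ tgt g = hsrc h) \/ (2 <= mult (hsrc h))%N.
Hypothesis D_out : forall h, h \in D ->
  (exists2 g, g \in D & g != hinv h /\ hsrc g = tgt h) \/ (2 <= mult (tgt h))%N.

Lemma curve_infinite_type (A : algType k) : D != set0 ->
  is_sf_brauer_graph_algebra B A -> ~ finite_representation_type A.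
Proof.
case/set0Pn=> h0 h0D [f [fM fB]].
pose C := [set h | (h \in D) || (hinv h \in D)].
have CD h : h \in D -> h \in C by rewrite inE => ->.
have C_inv h : h \in C -> hinv h \in C by rewrite !inE hinvK orbC.
have C_unl h : h \in C -> edge_of h \notin labels B.
  by rewrite inE => /orP[/D_unlabeled //|/D_unlabeled]; rewrite edge_of_inv.
have out g h : hinv g \in D -> hinv h \in D -> hsrc g = hsrc h -> g = h.
  by move=> gD hD e; apply: (can_inj (@hinvK B)); apply: D_tgt; rewrite ?hinvK.
have C_two g h h' : g \in C -> h \in C -> h' \in C ->
    hsrc g = hsrc h -> hsrc g = hsrc h' -> [\/ g = h, g = h' | h = h'].
  rewrite !inE => gC hC hC' e e'; have e2 : hsrc h = hsrc h' by rewrite -e.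
  case/orP: gC => gD; case/orP: hC => hD; case/orP: hC' => hD';
    do ?[by constructor 1; apply: D_src | by constructor 1; apply: out
        |by constructor 2; apply: D_src | by constructor 2; apply: out
        |by constructor 3; apply: D_src | by constructor 3; apply: out].
have C_one g : g \in C -> (exists2 h, h \in C & h != g /\ hsrc h = hsrc g) \/
    (2 <= mult (hsrc g))%N.
  rewrite inE => /orP[gD|gD].
    have [[h hD [ne e]]|m2] := D_in gD; [left | by right].
    by exists (hinv h) => //; apply/C_inv/CD.
  have [[h hD]|] := D_out gD; rewrite hinvK; last by right.
  by move=> he; left; exists h => //; apply: CD.
apply: unbounded_infinite_type => n.
exact: (stroll_module labels_neqT C_inv C_unl C_two C_one (CD _ h0D) n fM fB).
Qed.

End Curve.

Lemma uniq_map_inj_in (S T : eqType) (g : S -> T) s :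
  uniq (map g s) -> {in s &, injective g}.
Proof.
elim: s => //= a s IH /andP[na us] x y; rewrite !inE.
case/orP=> [/eqP->|xs]; case/orP=> [/eqP->|ys] // e.
- by rewrite e map_f in na.
- by rewrite -e map_f in na.
- exact: IH.
Qed.

(** A cycle is a curve without ends; a curve cannot turn back along the edge by which
it came, because the edges of a cycle are distinct. *)
Lemma cycle_infinite_type (A : algType k) (c : seq (halfedge G)) : is_cycle c ->
  is_sf_brauer_graph_algebra B A -> ~ finite_representation_type A.
Proof.
case=> c0 cyc /uniq_map_inj_in us /[dup] ue /uniq_map_inj_in ie.
have uc : uniq c := map_uniq ue.
have nx x : x \in c -> hsrc (hinv x) = hsrc (next c x).
  by move=> xc; apply/eqP; apply: (next_cycle cyc).
have noflip x y : x \in c -> y \in c -> hinv x <> y.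
  move=> xc yc e; have exy : x = y by apply: ie => //; rewrite -e edge_of_inv.
  by have := hinv_neq x; rewrite {2}exy e eqxx.
apply: (@curve_infinite_type [set val x | x in c]).
- by move=> _ /imsetP[x _ ->]; exact: (valP x).
- move=> _ _ /imsetP[x xc ->] /imsetP[y yc ->] e.
  by congr val; apply: us.
- move=> _ _ /imsetP[x xc ->] /imsetP[y yc ->] e; congr val.
  rewrite -[x](prev_next uc) -[y](prev_next uc); congr prev.
  by apply: us; rewrite ?mem_next // -!nx.
- move=> _ /imsetP[x xc ->]; left; exists (val (prev c x)).
    by apply: imset_f; rewrite mem_prev.
  have pc : prev c x \in c by rewrite mem_prev.
  split; last by have := nx _ pc; rewrite next_prev.
  by apply/eqP => e; apply: (noflip _ _ pc xc); apply: val_inj.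
- move=> _ /imsetP[x xc ->]; left; exists (val (next c x)).
    by apply: imset_f; rewrite mem_next.
  have nc : next c x \in c by rewrite mem_next.
  split; last exact: (esym (nx _ xc)).
  by apply/eqP => e; apply: (noflip _ _ xc nc); apply/esym/val_inj.
have [x xc] : exists x, x \in c.
  by case: (c) c0 => [|x s _]; [rewrite eqxx | exists x; rewrite mem_head].
by apply/set0Pn; exists (val x); apply: imset_f.
Qed.

(** A simple path between the two vertices is a curve. *)
Lemma two_exceptional_infinite_type (A : algType k) (v w : vertex B) : v != w ->
  (2 <= mult v)%N -> (2 <= mult w)%N ->
  is_sf_brauer_graph_algebra B A -> ~ finite_representation_type A.
Proof.
move=> vw mv mw; have /connectP[p0 pp0 ew0] := delete_connected.2 v w.
have [p [pp up ew]] : exists p, [/\ path (adjacent (G := G)) v p, uniq (v :: p) & w = last v p].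
  by case/shortenP: pp0 ew0 => p pp up _ ->; exists p; split.
pose V i := nth v (v :: p) i.
have V_inj i j : (i <= size p)%N -> (j <= size p)%N -> V i = V j -> i = j.
  by move=> li lj /eqP; rewrite nth_uniq // => /eqP.
have /fin_all_exists[hf hfP] (i : 'I_(size p)) : exists h : unlabeled B,
    hsrc (val h) = V i /\ hsrc (hinv (val h)) = V i.+1.
  have := (pathP v pp) i (ltn_ord i).
  by case/existsP=> h /andP[/eqP e1 /eqP e2]; exists h.
have le (i : 'I_(size p)) : (i <= size p)%N := ltnW (ltn_ord i).
apply: (@curve_infinite_type [set val (hf i) | i : 'I_(size p)]).
- by move=> _ /imsetP[i _ ->]; exact: (valP (hf i)).
- move=> _ _ /imsetP[i _ ->] /imsetP[j _ ->].
  rewrite (hfP i).1 (hfP j).1 => e; congr (val (hf _)); apply: val_inj.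
  exact: V_inj (le i) (le j) e.
- move=> _ _ /imsetP[i _ ->] /imsetP[j _ ->].
  rewrite (hfP i).2 (hfP j).2 => e; congr (val (hf _)); apply: val_inj.
  by case: (V_inj _ _ (ltn_ord i) (ltn_ord j) e).
- move=> _ /imsetP[i _ ->]; rewrite (hfP i).1.
  case: i => [[|i] lt] /=; [by right | left].
  have li : (i < size p)%N := ltnW lt.
  exists (val (hf (Ordinal li))); first exact: imset_f.
  split; last by rewrite (hfP _).2.
  apply/eqP => e; have := congr1 (fun h => hsrc (hinv h)) e.
  rewrite /= hinvK (hfP _).1 (hfP _).2 => /V_inj /= h.
  by move/eqP: (h (ltnW li) lt); rewrite ltn_eqF.
- move=> _ /imsetP[i _ ->]; rewrite (hfP i).2.
  case: (ltnP i.+1 (size p)) => [lt|ge]; [left | right].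
    exists (val (hf (Ordinal lt))); first exact: imset_f.
    split; last by rewrite (hfP _).1.
    apply/eqP => e; have := congr1 (fun h => hsrc (hinv h)) e.
    rewrite /= hinvK (hfP _).1 (hfP _).2 => /V_inj /= h.
    by move/eqP: (h lt (le i)); rewrite gtn_eqF.
  have -> : i.+1 = size p by apply/eqP; rewrite eqn_leq ge ltn_ord.
  by rewrite /V nth_last /= -ew.
have sp : (0 < size p)%N.
  by rewrite lt0n size_eq0; apply: contraNneq vw => sp; rewrite ew sp.
by apply/set0Pn; exists (val (hf (Ordinal sp))); apply: imset_f.
Qed.

End Combinatorics.

Theorem proposition0p3 (k : fieldType) (B : sfBrauerGraph)
    (labels_neqT : labels B != [set: edge B]) (A : algType k) :
  is_sf_brauer_graph_algebra B A ->
  finite_representation_type A ->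
  brauer_tree (G := delete_labeled labels_neqT) (@mult B).
Proof.
move=> sfA finA; split.
  split; first exact: delete_connected.
  by move=> c /cycle_infinite_type/(_ sfA).
have [n0 _] := lrg_connected B; have /card_gt0P[v1 _] := n0.
have [[v mv]|none] := pselect (exists v, (2 <= mult (s := B) v)%N).
  exists v => w wv; apply/eqP; rewrite eqn_leq mult_gt0 andbT leqNgt.
  apply/negP => mw.
  exact: (two_exceptional_infinite_type labels_neqT wv mw mv sfA finA).
exists v1 => w _; apply/eqP; rewrite eqn_leq mult_gt0 andbT leqNgt.
by apply/negP => mw; case: none; exists w.
Qed.
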